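(* Let $(\Omega,T,\mu)$ be a topologically mixing piecewise expanding Markov system with $\mu$ an equilibrium state of a potential that is Hölder continuous on each interior of the Markov partition elements, let $I\subset\Omega$ be a union of cylinders, $\varphi=\mathbf{1}_I$ satisfying condition (NA), $\alpha$ an irrational number, and let $S:M\to M$, $M=\Omega\times\mathbb{T}$, $S(\omega,t)=(T\omega,t+\alpha\varphi(\omega))$, with invariant measure $\nu=\mu\times\mathrm{Leb}$ (all as specified in the context). Then for $\nu\times\nu$-a.e. $(x,y)\in M\times M$, $$\limsup_{n\to\infty}\frac{\log\mathbb{M}_{S,n}(x,y)}{-\log n}\le\min\left(\frac{2}{C_\nu},1\right)=\min\left(\frac{2}{C_\mu+1},1\right)$$ and $$\liminf_{n\to\infty}\frac{\log\mathbb{M}_{S,n}(x,y)}{-\log n}\le\min\left(\frac{2}{C_\nu},\frac{1}{\gamma(\alpha)}\right)=\min\left(\frac{2}{C_\mu+1},\frac{1}{\gamma(\alpha)}\right).$$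
   Context: Setting. $\Omega$ is a finite-dimensional Riemannian manifold with distance $d$ and $T:\Omega\to\Omega$ is a piecewise expanding Markov map: there is $\beta>1$ with $\|D_xT^{-1}\|\le\beta^{-1}$ for every $x\in\Omega$, and there is a finite collection (Markov partition) $\mathcal{J}=\{J_1,\dots,J_p\}$ of closed proper sets such that (M1) $T$ is a $C^{1+\eta}$ diffeomorphism from $\mathrm{int}\,J_i$ onto its image; (M2) $\Omega=\bigcup_iJ_i$ and $\mathrm{int}\,J_i\cap\mathrm{int}\,J_j=\emptyset$ unless $i=j$; (M3) $T(J_i)\supset J_j$ whenever $T(\mathrm{int}\,J_i)\cap\mathrm{int}\,J_j\ne\emptyset$. Such a $T$ is semi-conjugated to a subshift of finite type. $T$ is topologically mixing, equivalently for each $i$ there is $n_i$ with $T^{n_i}J_i=\Omega$. The $T$-invariant probability measure $\mu$ is the equilibrium state of a potential $\psi:\Omega\to\mathbb{R}$ which is Hölder continuous on each $\mathrm{int}\,J_i$. Cylinders of size $q$ are the sets $J_{i_0,\dots,i_{q-1}}=\bigcap_{n=0}^{q-1}T^{-n}J_{i_n}$. In this setting the correlation dimension $C_\mu$ exists. Skew product. $\mathbb{T}=\mathbb{R}/\mathbb{Z}$; $I\subset\Omega$ is a union of cylinders and $\varphi=\mathbf{1}_I$. $M=\Omega\times\mathbb{T}$ carries the sup distance $\max(d(\omega,\tilde\omega),\|t-s\|)$, where $\|\cdot\|$ is the distance to the nearest integer. Standing assumption (NA): for any $u\in[-\pi,\pi]$, the equation $fe^{iu\varphi}=\lambda f\circ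 T$, where $f$ is Hölder (on the subshift) and $\lambda\in S^1$, has only the trivial solutions $\lambda=1$ and $f$ constant. Irrationality exponent: $\gamma(\alpha)=\inf\{\beta:\liminf_{q\to\infty}q^{\beta}\|q\alpha\|>0\}\in[1,\infty]$ (with $1/\infty=0$). Shortest distance: $\mathbb{M}_{S,n}(x,y)=\min_{0\le i,j\le n-1}d_M(S^i(x),S^j(y))$, $d_M$ being the sup distance on $M$ (convention $\log0=-\infty$). Correlation dimension: for a Borel probability measure $m$ on a metric space, $C_m=\lim_{r\to0}\frac{\log\int m(B(x,r))\,dm(x)}{\log r}$ when the limit exists. One has $C_\nu=C_\mu+1$. *)

(* Defs.v *)
From HB Require Import structures.
From mathcomp Require Import all_boot all_order all_algebra.
From mathcomp Require Import generic_quotient ring_quotient archimedean.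
From mathcomp Require Import all_classical all_reals all_analysis.
From mathcomp.real_closed Require Import complex.

Set Implicit Arguments.
Unset Strict Implicit.
Unset Printing Implicit Defensive.

Import Order.TTheory GRing.Theory Num.Theory.
Import numFieldNormedType.Exports.

Local Open Scope classical_set_scope.
Local Open Scope ring_scope.
Local Open Scope quotient_scope.

HB.mixin Record isBorel d (R : realType) Omega
    & Measurable d Omega & Metric R Omega := {
  measurable_borel : @measurable d Omega = <<s [set U : set Omega | open U] >>
}.

#[short(type="borelMetricType")]
HB.structure Definition BorelMetric d (R : realType) :=
  {Omega of isBorel d R Omega & Measurable d Omega & Metric R Omega}.

Fixpoint Ck (R : realType) (n : nat) (V : normedModType R) (k : nat)
    (U : set 'rV[R]_n) (f : 'rV[R]_n -> V) : Prop :=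
  match k with
  | 0%N => forall z, U z -> {for z, continuous f}
  | k'.+1 => (forall z, U z -> differentiable f z) /\
             (forall v, Ck k' U (fun z => 'D_v f z))
  end.

Definition smooth_on (R : realType) (n : nat) (V : normedModType R)
    (U : set 'rV[R]_n) (f : 'rV[R]_n -> V) : Prop :=
  forall k, Ck k U f.

(* Tangent vectors at x are written in the coordinates of the preferred chart
   [chart_at x], so that the tangent space at x is 'rV[R]_n.  Linear maps act on
   row vectors from the right, as for [jacobian]. *)
Record smooth_manifold (R : realType) (n : nat) (Omega : metricType R) := {
  chart_index : Type ;
  chart_dom : chart_index -> set Omega ;
  chart : chart_index -> Omega -> 'rV[R]_n ;
  chart_inv : chart_index -> 'rV[R]_n -> Omega ;
  chart_at : Omega -> chart_index ;
  chart_atP : forall x, chart_dom (chart_at x) x ;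
  chart_dom_open : forall a, open (chart_dom a) ;
  chart_im_open : forall a, open (chart a @` chart_dom a) ;
  chartK : forall a x, chart_dom a x -> chart_inv a (chart a x) = x ;
  chart_continuous : forall a x, chart_dom a x -> {for x, continuous (chart a)} ;
  chart_inv_continuous : forall a x, chart_dom a x ->
    {for chart a x, continuous (chart_inv a)} ;
  transition_smooth : forall a b,
    smooth_on (chart a @` (chart_dom a `&` chart_dom b)) (chart b \o chart_inv a) ;
  smooth_manifold_second_countable : @second_countable Omega
}.

Arguments chart_dom {R n Omega} X a _ : rename.
Arguments chart {R n Omega} X a _ : rename.
Arguments chart_inv {R n Omega} X a _ : rename.
Arguments chart_at {R n Omega} X _ : rename.

Section Riemannian.
Context {R : realType} {n : nat} {Omega : metricType R}.

(* [gram g x] is the Gram matrix of the metric at x in the chart [chart_at x];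
   smoothness is that of its expression in every chart of the atlas. *)
Record riemannian_metric (X : smooth_manifold n Omega) := {
  gram : Omega -> 'M[R]_n ;
  gram_sym : forall x, (gram x)^T = gram x ;
  gram_pos : forall x (v : 'rV[R]_n), v != 0 ->
    0 < (v *m gram x *m v^T) ord0 ord0 ;
  gram_smooth : forall a, smooth_on (chart X a @` chart_dom X a) (fun z =>
    let x := chart_inv X a z in
    let A := jacobian (chart X (chart_at X x) \o chart_inv X a) z in
    A *m gram x *m A^T)
}.

Variables (X : smooth_manifold n Omega) (g : riemannian_metric X).

Definition tangent_norm (x : Omega) (v : 'rV[R]_n) : R :=
  Num.sqrt ((v *m gram g x *m v^T) ord0 ord0).

Definition velocity (c : R -> Omega) (t : R) : 'rV[R]_n :=
  derive1 (chart X (chart_at X (c t)) \o c) t.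

Definition C1_curve (c : R -> Omega) : Prop :=
  forall t, t \in `[0, 1] ->
    let h := chart X (chart_at X (c t)) \o c in
    (\forall s \near t, {for s, continuous c} /\ derivable h s 1) /\
    {for t, continuous (derive1 h)}.

Definition curve_length (c : R -> Omega) : \bar R :=
  (\int[lebesgue_measure]_(t in `[0%R, 1%R]) (tangent_norm (c t) (velocity c t))%:E)%E.

(* [piecewise_C1 x y l]: some concatenation of finitely many C^1 curves
   parametrized by [0, 1] goes from x to y and has length l. *)
Inductive piecewise_C1 : Omega -> Omega -> \bar R -> Prop :=
| piecewise_C1_nil x : piecewise_C1 x x 0%E
| piecewise_C1_cons c y l : C1_curve c -> piecewise_C1 (c 1) y l ->
    piecewise_C1 (c 0) y (curve_length c + l)%E.

(* As the right-hand side is finite, this also forces connectedness. *)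
Definition is_riemannian_distance : Prop :=
  forall x y : Omega,
    ereal_inf [set l | piecewise_C1 x y l] = (mdist x y)%:E.

Definition tangent_map (T : Omega -> Omega) (x : Omega) : 'M[R]_n :=
  jacobian (chart X (chart_at X (T x)) \o T \o chart_inv X (chart_at X x))
           (chart X (chart_at X x) x).

End Riemannian.

(* C^(1+eta) on U in the local sense: near each point of U, the derivative in any
   pair of charts is eta-Hölder. *)
Definition C1_holder (R : realType) (n : nat) (Omega : metricType R)
    (X : smooth_manifold n Omega) (eta : R) (U : set Omega)
    (f : Omega -> Omega) : Prop :=
  forall x, U x -> {for x, continuous f} /\
    forall a b, chart_dom X a x -> chart_dom X b (f x) ->
      let F := chart X b \o f \o chart_inv X a in
      exists2 W : set 'rV[R]_n, nbhs (chart X a x) W &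
        (forall z, W z -> differentiable F z) /\
        exists C : R, forall y z, W y -> W z ->
          `|jacobian F y - jacobian F z| <= C * `|y - z| `^ eta.

Definition C1_holder_diffeo (R : realType) (n : nat) (Omega : metricType R)
    (X : smooth_manifold n Omega) (eta : R) (U : set Omega)
    (f : Omega -> Omega) : Prop :=
  open (f @` U) /\ C1_holder X eta U f /\
  exists finv : Omega -> Omega,
    (forall x, U x -> finv (f x) = x) /\ C1_holder X eta (f @` U) finv.

(* The derivative of T only makes sense in the interiors of the elements of the
   partition.  "Proper" has its usual meaning for Markov partitions: equal to the
   closure of its interior. *)
Record piecewise_expanding_markov (R : realType) (n : nat)
    (Omega : metricType R) (X : smooth_manifold n Omega)
    (g : riemannian_metric X) (T : Omega -> Omega) (p : nat)
    (J : 'I_p -> set Omega) (beta eta : R) : Prop := {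
  expansion_gt1 : 1 < beta ;
  holder_exponent_gt0 : 0 < eta ;
  expanding : forall i x, (J i)° x -> forall w : 'rV[R]_n,
    tangent_norm g x (w *m invmx (tangent_map X T x))
      <= beta^-1 * tangent_norm g (T x) w ;
  markov_closed : forall i, closed (J i) ;
  markov_proper : forall i, J i = closure (J i)° ;
  markov_diffeo : forall i, C1_holder_diffeo X eta (J i)° T ;
  markov_cover : \bigcup_i J i = [set: Omega] ;
  markov_disjoint : forall i j, i != j -> (J i)° `&` (J j)° = set0 ;
  markov_image : forall i j,
    T @` (J i)° `&` (J j)° !=set0 -> J j `<=` T @` J i
}.

Definition topologically_mixing (Omega : topologicalType)
    (T : Omega -> Omega) : Prop :=
  forall U V : set Omega, open U -> open V -> U !=set0 -> V !=set0 ->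
    exists N : nat, forall k, (N <= k)%N -> iter k T @^-1` U `&` V !=set0.

Definition cylinder (Omega : Type) (T : Omega -> Omega) (p : nat)
    (J : 'I_p -> set Omega) (w : seq 'I_p) : set Omega :=
  [set x | forall k i, onth w k = Some i -> J i (iter k T x)].

Definition cylinder_union (Omega : Type) (T : Omega -> Omega) (p : nat)
    (J : 'I_p -> set Omega) (W : set (seq 'I_p)) : set Omega :=
  \bigcup_(w in W) cylinder T J w.

Definition invariant_measure (R : realType) d (Omega : measurableType d)
    (T : Omega -> Omega) (m : set Omega -> \bar R) : Prop :=
  forall A, measurable A -> m (T @^-1` A) = m A.

(* A finite measurable partition is given by a labelling P : Omega -> 'I_k; its
   refinement under T, ..., T^(n-1) has the atoms [refinement_atom T P w]. *)
Definition refinement_atom (Omega : Type) (T : Omega -> Omega) (k : nat)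
    (P : Omega -> 'I_k) (n : nat) (w : {ffun 'I_n -> 'I_k}) : set Omega :=
  [set x | forall j : 'I_n, P (iter j T x) = w j].

Definition refinement_entropy (R : realType) (Omega : Type)
    (T : Omega -> Omega) (m : set Omega -> \bar R) (k : nat)
    (P : Omega -> 'I_k) (n : nat) : R :=
  - \sum_(w : {ffun 'I_n -> 'I_k})
      fine (m (refinement_atom T P w)) * ln (fine (m (refinement_atom T P w))).

Definition partition_entropy (R : realType) (Omega : Type)
    (T : Omega -> Omega) (m : set Omega -> \bar R) (k : nat)
    (P : Omega -> 'I_k) : R :=
  limn (fun n => refinement_entropy T m P n / n%:R).

Definition ks_entropy (R : realType) d (Omega : measurableType d)
    (T : Omega -> Omega) (m : set Omega -> \bar R) : \bar R :=
  ereal_sup [set h | exists (k : nat) (P : Omega -> 'I_k),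
    (forall i, measurable (P @^-1` [set i])) /\
    h = (partition_entropy T m P)%:E].

Definition is_equilibrium_state (R : realType) d (Omega : measurableType d)
    (T : Omega -> Omega) (psi : Omega -> R) (mu : probability Omega R) : Prop :=
  [/\ invariant_measure T mu,
      mu.-integrable setT (EFin \o psi) &
      forall eta : probability Omega R, invariant_measure T eta ->
        eta.-integrable setT (EFin \o psi) ->
        (ks_entropy T eta + \int[eta]_x (psi x)%:E
           <= ks_entropy T mu + \int[mu]_x (psi x)%:E)%E].

Definition holder_on (R : realType) (Omega : metricType R) (A : set Omega)
    (psi : Omega -> R) : Prop :=
  exists C theta : R, 0 < theta /\
    forall x y, A x -> A y -> `|psi x - psi y| <= C * mdist x y `^ theta.

Section Subshift.
Context {R : realType} {Omega : topologicalType}.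
Variables (T : Omega -> Omega) (p : nat) (J : 'I_p -> set Omega).

Definition subshift : set (nat -> 'I_p) :=
  [set x | forall k, T @` (J (x k))° `&` (J (x k.+1))° !=set0].

Definition shift (x : nat -> 'I_p) : nat -> 'I_p := fun k => x k.+1.

Definition symbolic_cylinder (w : seq 'I_p) : set (nat -> 'I_p) :=
  [set x | w = mkseq x (size w)].

Definition symbolic_union (W : set (seq 'I_p)) : set (nat -> 'I_p) :=
  \bigcup_(w in W) symbolic_cylinder w.

(* Hölder continuity for the distances theta^min{k | x k != y k}. *)
Definition subshift_holder (f : (nat -> 'I_p) -> R[i]) : Prop :=
  exists C theta : R, 0 < theta < 1 /\
    forall x y, subshift x -> subshift y ->
      forall k, (forall j, (j < k)%N -> x j = y j) ->
        `|f x - f y| <= (C * theta ^+ k)%:C%C.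

(* The function f = 0 solves the equation for every lambda, and is excluded. *)
Definition condition_NA (W : set (seq 'I_p)) : Prop :=
  forall (u : R) (f : (nat -> 'I_p) -> R[i]) (lambda : R[i]),
    - pi <= u <= pi -> subshift_holder f -> `|lambda| = 1 ->
    (exists2 x, subshift x & f x != 0) ->
    (forall x, subshift x ->
       let phi : R := \1_(symbolic_union W) x in
       f x * (cos (u * phi) +i* sin (u * phi))%C = lambda * f (shift x)) ->
    lambda = 1 /\ exists c, forall x, subshift x -> f x = c.

End Subshift.

Arguments condition_NA R {Omega} T {p} J W.

Definition dist_int (R : realType) (x : R) : R :=
  inf [set `|x - m%:~R| | m in [set: int]].

Definition circle (R : realType) : Type :=
  Quotient.quot (GRing.ZmodClosed.clone R (@Num.int_num_subdef R) _).

HB.instance Definition _ (R : realType) := GRing.Zmodule.on (circle R).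
HB.instance Definition _ (R : realType) := EqQuotient.on (circle R).
HB.instance Definition _ (R : realType) := isPointed.Build (circle R) 0.

Definition circle_proj (R : realType) (x : R) : circle R := \pi_(circle R) x.

Definition circle_dist (R : realType) (s t : circle R) : R :=
  dist_int (repr (s - t)).

Section CircleMeasurable.
Variable R : realType.

(* The quotient sigma-algebra, which is the Borel one. *)
Definition circle_measurable : set (set (circle R)) :=
  [set A | measurable (@circle_proj R @^-1` A)].

Lemma circle_measurable0 : circle_measurable set0.
Proof. by rewrite /circle_measurable/= preimage_set0. Qed.

Lemma circle_measurableC A : circle_measurable A -> circle_measurable (~` A).
Proof.
by rewrite /circle_measurable/= preimage_setC => mA; exact: measurableC.
Qed.

Lemma circle_measurable_bigcup (F : (set (circle R))^nat) :
  (forall k, circle_measurable (F k)) -> circle_measurable (\bigcup_k F k).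
Proof.
rewrite /circle_measurable/= => mF; rewrite preimage_bigcup.
exact: bigcup_measurable.
Qed.

HB.instance Definition _ := @isMeasurable.Build default_measure_display
  (circle R) circle_measurable circle_measurable0 circle_measurableC
  circle_measurable_bigcup.

Lemma measurable_circle_proj : measurable_fun [set: R] (@circle_proj R).
Proof. by move=> _ A mA; rewrite setTI. Qed.

Definition circle_lebesgue (A : set (circle R)) : \bar R :=
  lebesgue_measure (@circle_proj R @^-1` A `&` `[0, 1[).

Let circle_lebesgue0 : circle_lebesgue set0 = 0%E.
Proof. by rewrite /circle_lebesgue preimage_set0 set0I measure0. Qed.

Let circle_lebesgue_ge0 A : (0 <= circle_lebesgue A)%E.
Proof. exact: measure_ge0. Qed.

Let circle_lebesgue_sigma_additive : semi_sigma_additive circle_lebesgue.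
Proof.
move=> F mF tF _.
have mpF k : measurable (@circle_proj R @^-1` F k) by exact: mF.
rewrite /circle_lebesgue preimage_bigcup setI_bigcupl.
apply: (@measure_semi_sigma_additive _ _ _ lebesgue_measure
  (fun k => @circle_proj R @^-1` F k `&` `[0, 1[)).
- by move=> k; apply: measurableI; [exact: mpF|exact: measurable_itv].
- apply/trivIsetP => i j _ _ ij; rewrite setIACA -preimage_setI.
  by move/trivIsetP : tF => -> //; rewrite preimage_set0 set0I.
- by apply: bigcup_measurable => k _; apply: measurableI; [exact: mpF|exact: measurable_itv].
Qed.

HB.instance Definition _ := isMeasure.Build _ _ _ circle_lebesgue
  circle_lebesgue0 circle_lebesgue_ge0 circle_lebesgue_sigma_additive.

Let circle_lebesgue_setT : circle_lebesgue setT = 1%E.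
Proof.
rewrite /circle_lebesgue preimage_setT setTI.
by rewrite lebesgue_measure_itv/= lte_fin ltr01 sube0.
Qed.

HB.instance Definition _ := Measure_isProbability.Build _ _ _ circle_lebesgue
  circle_lebesgue_setT.

End CircleMeasurable.

Section SkewProduct.
Context d (R : realType) (Omega : borelMetricType d R).

Definition skew_product (T : Omega -> Omega) (alpha : R) (I : set Omega)
    (x : Omega * circle R) : Omega * circle R :=
  (T x.1, x.2 + circle_proj (alpha * \1_I x.1)).

Definition skew_dist (x y : Omega * circle R) : R :=
  Order.max (mdist x.1 y.1) (circle_dist x.2 y.2).

(* Omega is second countable when it is a manifold, so the product sigma-algebra
   is the Borel one. *)
Definition skew_measure (mu : probability Omega R) :
    set (Omega * circle R) -> \bar R :=
  (mu \x @circle_lebesgue R)%E.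

HB.instance Definition _ mu := Measure.on (skew_measure mu).

Let skew_measure_setT mu : skew_measure mu setT = 1%E.
Proof.
rewrite /skew_measure -setXTT [LHS]product_measure1E// -[RHS]mule1.
by congr (_ * _)%E; exact: probability_setT.
Qed.

HB.instance Definition _ mu := Measure_isProbability.Build _ _ _
  (skew_measure mu) (skew_measure_setT mu).

End SkewProduct.

Arguments skew_dist {d R Omega} x y.

Definition is_correlation_dimension (R : realType) d (E : measurableType d)
    (dist : E -> E -> R) (m : set E -> \bar R) (C : R) : Prop :=
  ln (fine (\int[m]_x m [set y | (dist x y < r)%R])%E) / ln r @[r --> 0^'+] --> C.

(* In \bar R the minimum over the empty family, at n = 0, is +oo. *)
Definition shortest_distance (R : realType) (E : Type) (dist : E -> E -> R)
    (S : E -> E) (n : nat) (x y : E) : \bar R :=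
  \big[Order.min/+oo%E]_(i < n) \big[Order.min/+oo%E]_(j < n)
    (dist (iter i S x) (iter j S y))%:E.

(* [lne 0 = -oo], so that the quotient is +oo when the shortest distance is 0. *)
Definition log_shortest_distance (R : realType) (E : Type) (dist : E -> E -> R)
    (S : E -> E) (x y : E) (n : nat) : \bar R :=
  (lne (shortest_distance dist S n x y) / (- ln n%:R)%:E)%E.

Definition irrationality_exponent (R : realType) (alpha : R) : \bar R :=
  ereal_inf [set b%:E | b in [set b : R |
    (0 < limn_einf (fun q : nat => (q%:R `^ b * dist_int (q%:R * alpha))%:E))%E]].

(* Main.v *)
Require Import Defs.
From HB Require Import structures.
From mathcomp Require Import all_boot all_order all_algebra.
From mathcomp Require Import all_classical all_reals all_analysis.
From mathcomp Require Import measurable_realfun zify lra ring.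

Set Implicit Arguments.
Unset Strict Implicit.
Unset Printing Implicit Defensive.

Import Order.TTheory GRing.Theory Num.Theory.
Import numFieldNormedType.Exports.

Local Open Scope classical_set_scope.
Local Open Scope ring_scope.

(* Everything but the invariance of [mu] is elementary probability.  As [S]
   preserves [nu], the set of pairs with [d(S^i x, S^j y) < r] has measure
   [\int nu(B(x, r)) dnu(x)], so a union bound over [i, j < n] and the
   Borel-Cantelli lemma along [n = 2^k] give limsup <= 2 / C_nu.  The circle
   coordinates of [S^i x] and [S^j y] differ by [x2 - y2 + k alpha] with
   [|k| < n]; a union bound over these 2n values gives limsup <= 1.  When
   [||q alpha|| < q^-b], the points [k alpha] cluster around the [q] points
   [j alpha], [j < q], and the union bound needs only [q] arcs; with
   [n = q^c], [1 < c < b < gamma], this gives liminf <= 1 / c. *)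

(** With [r = n^-a], the three bounds on measures are of order [n^(2 - a s)] for any [s] below the
    dimension, [n^(1 - a)], and [q^(1 - a c) + q^(c - b)] when [n] is about [q^c]; the stated rates
    are the values of [a] at which these cease to decay. An upper limit needs control of every [n],
    but a small negative power of [n] is not summable. Along powers of two it becomes geometric, and
    monotonicity of the shortest distance in [n] fills the gaps. A lower limit only needs measures
    that are arbitrarily small for large [n], so nothing is required of the spacing of the good [q].
    The dimension of the skew product exceeds that of the base by one because a ball for the sup
    distance is a ball times an arc of length [2 r]. Since [ln] is total with [ln 0 = 0], logarithms
    are undone only after the correlation integral is shown positive. Separability gives this
    positivity, and also places the sets [dist x y < r] in the product sigma-algebra. *)

(** * Upper and lower limits of logarithmic ratios *)

Lemma limn_esup_le_near (R : realType) (u : (\bar R)^nat) (l : \bar R) :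
  (\forall n \near \oo, (u n <= l)%E) -> (limn_esup u <= l)%E.
Proof.
move=> ul; rewrite /limn_esup /limf_esup.
apply: ge_ereal_inf; exists (ereal_sup (u @` [set n | (u n <= l)%E])).
  by exists [set n | (u n <= l)%E].
by apply: ge_ereal_sup => _ [n/= ? <-].
Qed.

Lemma limn_einf_le_frequently (R : realType) (u : (\bar R)^nat) (l : \bar R) :
  (forall N, exists2 n, (N <= n)%N & (u n <= l)%E) -> (limn_einf u <= l)%E.
Proof.
move=> ul; rewrite /limn_einf /limn_esup /limf_esup leeNl.
apply: le_ereal_inf_tmp => _ [V [N _ NV] <-].
have [n Nn unl] := ul N.
apply: le_ereal_sup_tmp; exists (- u n)%E; last by rewrite leeN2.
by exists n => //; exact: NV.
Qed.

(** For [n > 1] the divisor [- ln n] is negative, so the inequality is reversed; an infinite [m]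
    gives the quotient [-oo]. *)
Lemma log_ratio_le (R : realType) (m : \bar R) (n : nat) (a : R) :
  (1 < n)%N -> ((n%:R `^ (- a))%:E <= m)%E ->
  (lne m / (- ln n%:R)%:E <= a%:E)%E.
Proof.
move=> n1 nm.
have n0 : 0 < n%:R :> R by rewrite ltr0n (ltn_trans _ n1).
have l0 : 0 < ln (n%:R : R) by rewrite ln_gt0// ltr1n.
have lN0 : - ln (n%:R : R) < 0 by rewrite oppr_lt0.
case: m nm => [m| |].
- rewrite lee_fin => nm.
  have m0 : 0 < m by apply: lt_le_trans nm; rewrite powR_gt0.
  rewrite lne_EFin// inver (lt_eqF lN0) -EFinM lee_fin ler_ndivrMr//.
  rewrite mulrN -mulNr -ln_powR ler_ln// posrE//.
  by rewrite powR_gt0.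
- move=> _ /=; rewrite inver (lt_eqF lN0).
  by rewrite lt0_mulye ?leNye// lte_fin invr_lt0.
- by rewrite leeNy_eq.
Qed.

(* For [2 ^ k <= n < 2 ^ k.+1] the value at [n] is compared with the one at
   [2 ^ k.+1], which costs a factor [2] absorbed by [a < b]. *)
Lemma limn_esup_log_le_dyadic (R : realType) (M : (\bar R)^nat) (a b : R) :
  (forall m n, (m <= n)%N -> (M n <= M m)%E) -> 0 <= a -> a < b ->
  (\forall k \near \oo, (((2 ^ k)%:R `^ (- a))%:E <= M (2 ^ k)%N)%E) ->
  (limn_esup (fun n => lne (M n) / (- ln n%:R)%:E) <= b%:E)%E.
Proof.
move=> ndM a0 ab [K _ KM]; apply: limn_esup_le_near.
have ba0 : 0 < b - a by rewrite subr_gt0.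
(* For [n >= N0] this gives [a * ln 2 <= (b - a) * ln n], that is [2^a <= n^(b - a)]. *)
pose N0 := (Num.truncn (expR (a * ln 2 / (b - a)))).+1.
exists (maxn N0 (maxn 2 (2 ^ K))) => // n /=.
rewrite !geq_max => /and3P[N0n n2 Kn].
have n0 : 0 < n%:R :> R by rewrite ltr0n (leq_trans _ n2).
apply: log_ratio_le => //.
pose k := (trunc_log 2 n).+1.
have /andP[kn nk] := @trunc_log_bounds 2 n isT (leq_trans (isT : 1 <= 2)%N n2).
have Kk : (K <= k)%N.
  by rewrite ltnW// -(ltn_exp2l _ _ (isT : 1 < 2)%N) (leq_ltn_trans Kn).
apply: le_trans (ndM _ _ (ltnW nk)); apply: le_trans (KM _ Kk).
rewrite lee_fin /powR !gt_eqF// ?ltr0n ?expn_gt0// ler_expR !mulNr lerN2.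
have : (2 ^ k)%:R <= 2 * n%:R :> R.
  by rewrite /k expnS natrM ler_wpM2l// ler_nat.
rewrite -ler_ln ?posrE ?ltr0n ?expn_gt0 ?mulr_gt0// => kln.
apply: le_trans (ler_wpM2l a0 kln) _.
rewrite lnM ?posrE// mulrDr.
suff : a * ln 2 <= (b - a) * ln n%:R by lra.
rewrite -ler_pdivrMl// mulrC.
rewrite -ler_expR lnK ?posrE//.
apply/ltW/(lt_le_trans (truncnS_gt _)).
by rewrite ler_nat.
Qed.

(** * Distance to the nearest integer *)

Section dist_int.
Variable R : realType.
Implicit Types x y r : R.

Let dset x := [set `|x - m%:~R| | m in [set: int]].

Let dset_lbound x : has_lbound (dset x).
Proof. by exists 0 => _ [m _ <-]. Qed.

Let dset_inf x : has_inf (dset x).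
Proof. by split; [exists `|x - 0%:~R|; exists 0|exact: dset_lbound]. Qed.

Lemma dist_int_le x (m : int) : dist_int x <= `|x - m%:~R|.
Proof. by apply: ge_inf; [exact: dset_lbound|exists m]. Qed.

Lemma dist_int_ge0 x : 0 <= dist_int x.
Proof.
by apply: lb_le_inf => [|_ [m _ <-]//]; exists `|x - 0%:~R|; exists 0.
Qed.

(** An infimum is below [r] exactly when some element is, so the estimates can pick an integer
    without showing that the infimum is attained. *)
Lemma dist_int_ltP x r :
  dist_int x < r <-> exists m : int, `|x - m%:~R| < r.
Proof.
split=> [|[m]]; last exact/le_lt_trans/dist_int_le.
by move=> /(inf_lt (dset_inf x).1)[_ [m _ <-] xm]; exists m.
Qed.

Lemma dist_int_int (m : int) : dist_int (m%:~R : R) = 0.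
Proof.
apply/le_anti; rewrite dist_int_ge0 andbT.
by apply: le_trans (dist_int_le _ m) _; rewrite subrr normr0.
Qed.

Lemma dist_intD x y : dist_int (x + y) <= dist_int x + dist_int y.
Proof.
apply/ler_addgt0Pl => e e0.
have e2 : 0 < e / 2 by rewrite divr_gt0.
have [m xm] : exists m : int, `|x - m%:~R| < dist_int x + e / 2.
  by apply/dist_int_ltP; rewrite ltrDl.
have [n yn] : exists n : int, `|y - n%:~R| < dist_int y + e / 2.
  by apply/dist_int_ltP; rewrite ltrDl.
apply: le_trans (dist_int_le _ (m + n)) _.
rewrite intrD opprD addrACA; apply: le_trans (ler_normD _ _) _.
by lra.
Qed.

Lemma dist_intN x : dist_int (- x) = dist_int x.
Proof.
suff h y : dist_int (- y) <= dist_int y.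
  by apply/le_anti; rewrite h -{1}[x]opprK h.
apply/ler_addgt0Pl => e e0; rewrite addrC.
have [m ym] : exists m : int, `|y - m%:~R| < dist_int y + e.
  by apply/dist_int_ltP; rewrite ltrDl.
apply: le_trans (dist_int_le _ (- m)) _.
by rewrite intrN -opprD normrN ltW.
Qed.

Lemma dist_intB x y : dist_int (x - y) = dist_int (y - x).
Proof. by rewrite -dist_intN opprB. Qed.

Lemma dist_intDz x (m : int) : dist_int (x + m%:~R) = dist_int x.
Proof.
apply/le_anti/andP; split.
  by apply: le_trans (dist_intD _ _) _; rewrite dist_int_int addr0.
rewrite -{1}(addrK m%:~R x) -intrN.
by apply: le_trans (dist_intD _ _) _; rewrite dist_int_int addr0.
Qed.

Lemma dist_int_mulrn x n : dist_int (x *+ n) <= dist_int x *+ n.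
Proof.
elim: n => [|n IH]; first by rewrite !mulr0n (dist_int_int 0).
by rewrite !mulrS; apply: le_trans (dist_intD _ _) _; rewrite lerD2l.
Qed.

Lemma dist_int_mulz x (m : int) :
  dist_int (m%:~R * x) <= `|m|%N%:R * dist_int x.
Proof.
case: m => n; rewrite ?NegzE ?intrN ?mulNr ?dist_intN /= -pmulrn !mulr_natl;
  exact: dist_int_mulrn.
Qed.

End dist_int.

(** * The distance on the circle *)

Section circle_dist.
Variable R : realType.
Implicit Types (x y r : R) (s t u : circle R).

Lemma circle_projD x y :
  circle_proj (x + y) = circle_proj x + circle_proj y :> circle R.
Proof. exact: Quotient.pi_add. Qed.

Lemma circle_projN x : circle_proj (- x) = - circle_proj x :> circle R.
Proof. exact: Quotient.pi_opp. Qed.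

Lemma circle_projK s : circle_proj (repr s) = s.
Proof. exact: reprK. Qed.

Lemma circle_proj_int (m : int) : circle_proj m%:~R = 0 :> circle R.
Proof.
rewrite -(subrr (circle_proj 0)) -circle_projN -circle_projD subrr.
apply/eqP; rewrite -Quotient.idealrBE subr0; exact: intr_int.
Qed.

Lemma repr_circle_proj x :
  exists m : int, repr (circle_proj x : circle R) = x + m%:~R.
Proof.
have : repr (circle_proj x : circle R) - x \in Num.int_num_subdef.
  by rewrite Quotient.idealrBE reprK.
by move=> /intrP[m xm]; exists m; rewrite -xm addrC subrK.
Qed.

(** The representative chosen by [repr] differs from the given real by an integer, which [dist_int]
    ignores. Metric facts on the circle thus reduce to facts on the line. *)
Lemma circle_dist_proj x y :
  circle_dist (circle_proj x : circle R) (circle_proj y) = dist_int (x - y).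
Proof.
rewrite /circle_dist -circle_projN -circle_projD.
by have [m ->] := repr_circle_proj (x - y); rewrite dist_intDz.
Qed.

Lemma circle_distC s t : circle_dist s t = circle_dist t s.
Proof. by rewrite -[s]circle_projK -[t]circle_projK !circle_dist_proj dist_intB. Qed.

Lemma circle_dist_triangle t s u :
  circle_dist s u <= circle_dist s t + circle_dist t u.
Proof.
rewrite -[s]circle_projK -[t]circle_projK -[u]circle_projK !circle_dist_proj.
by apply: le_trans (dist_intD _ _); rewrite addrA subrK.
Qed.

Lemma circle_dist_translate s t u :
  circle_dist (s + u) (t + u) = circle_dist s t.
Proof. by rewrite /circle_dist opprD addrACA subrr addr0. Qed.

End circle_dist.

(** * Lebesgue measure on the circle: rotations and arcs *)

(** The image of Lebesgue measure under a translation has the right value on half-open intervals,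
    which determines the measure. *)
Lemma lebesgue_measure_translate (R : realType) (c : R) (A : set R) :
  measurable A ->
  lebesgue_measure ((fun x => x + c) @^-1` A) = lebesgue_measure A.
Proof.
have mc : measurable_fun [set: measurableTypeR R]
    ((fun x => x + c) : measurableTypeR R -> measurableTypeR R).
  by apply: continuous_measurable_fun => x; apply: cvgD; [exact: cvg_id|exact: cvg_cst].
pose f : {mfun measurableTypeR R >-> measurableTypeR R} := HB.pack
  ((fun x => x + c) : measurableTypeR R -> measurableTypeR R)
  (isMeasurableFun.Build _ _ _ _ _ mc).
move=> mA; rewrite -[LHS]/(pushforward lebesgue_measure f A).
apply/esym/lebesgue_measure_unique => //= _ [[a b] _ <-].
rewrite /pushforward.
have -> : f @^-1` `]a, b]%classic = `]a - c, b - c]%classic.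
  by apply/seteqP; split=> x /=; rewrite !in_itv/= ltrBlDr lerBrDr.
rewrite !lebesgue_measure_itv/= !lte_fin ltrD2r.
by case: ifPn => // _; rewrite -!EFinB; congr EFin; lra.
Qed.

Section circle_lebesgue.
Variable R : realType.
Implicit Types (s t : circle R) (r : R) (A : set (circle R)).

Let mproj A : measurable A -> measurable (@circle_proj R @^-1` A).
Proof. by []. Qed.

Let proj_translate A (m : int) :
  (fun x => x + m%:~R) @^-1` (@circle_proj R @^-1` A) = @circle_proj R @^-1` A.
Proof.
by apply/seteqP; split=> x /=; rewrite circle_projD circle_proj_int addr0.
Qed.

Lemma measurable_circle_translate s :
  measurable_fun [set: circle R] (fun t => t + s).
Proof.
move=> _ A mA; rewrite setTI.
suff h : measurable (@circle_proj R @^-1` ((fun t => t + s) @^-1` A)) by exact: h.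
have -> : @circle_proj R @^-1` ((fun t => t + s) @^-1` A) =
    (fun x => x + repr s) @^-1` (@circle_proj R @^-1` A).
  by apply/seteqP; split=> x /=; rewrite circle_projD circle_projK.
rewrite -[X in measurable X]setTI.
have mc : measurable_fun [set: measurableTypeR R]
    ((fun x => x + repr s) : measurableTypeR R -> measurableTypeR R).
  by apply: continuous_measurable_fun => x; apply: cvgD; [exact: cvg_id|exact: cvg_cst].
exact: mc.
Qed.

(** With the angle reduced to [c] in [[0, 1)], the rotation replaces the fundamental domain [[0, 1)]
    by [[c, 1 + c)]. The two share [[c, 1)], and by periodicity the remainder [[1, 1 + c)] has the
    same measure as [[0, c)]. *)
Lemma circle_lebesgue_translate s A : measurable A ->
  circle_lebesgue ((fun t => t + s) @^-1` A) = circle_lebesgue A.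
Proof.
move=> mA.
have [c [c0 c1 ->]] : exists c : R, [/\ 0 <= c, c < 1 & s = circle_proj c].
  exists (repr s - (Num.floor (repr s))%:~R); split.
  - by rewrite subr_ge0 floor_le.
  - by have := lt_succ_floor (repr s); rewrite intrD; lra.
  - by rewrite circle_projD circle_projN circle_proj_int oppr0 addr0 circle_projK.
set B := @circle_proj R @^-1` A.
have mB : measurable (B : set (measurableTypeR R)) by exact: mproj.
have -> : circle_lebesgue ((fun t => t + circle_proj c) @^-1` A) =
    lebesgue_measure (B `&` `[c, 1 + c[).
  rewrite -(@lebesgue_measure_translate _ c); last exact: measurableI.
  congr lebesgue_measure; apply/seteqP; split=> x /=;
    rewrite /B/= circle_projD !in_itv/= lerDr ltrD2r //.
have cE : `[c, 1 + c[%classic = `[c, 1[ `|` `[1, 1 + c[ :> set R.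
  by rewrite -itv_bndbnd_setU// bnd_simp ?lerDl// ltW.
have aE : `[0, 1[%classic = `[0, c[ `|` `[c, 1[ :> set R.
  by rewrite -itv_bndbnd_setU// bnd_simp ?lerDl// ltW.
rewrite /circle_lebesgue -/B cE aE !setIUr !measureU //; first last.
- rewrite setIACA setIid -subset0 => x/= []; rewrite !in_itv/=.
  by move=> _ [/andP[_ xc] /andP[cx _]]; rewrite ltNge cx in xc.
- exact: measurableI.
- exact: measurableI.
- rewrite setIACA setIid -subset0 => x/= []; rewrite !in_itv/=.
  by move=> _ [/andP[_ xc] /andP[cx _]]; rewrite ltNge cx in xc.
- exact: measurableI.
- exact: measurableI.
rewrite addeC; congr (_ + _)%E.
apply: etrans; first by
  apply/esym/(@lebesgue_measure_translate _ 1%:~R); exact: measurableI.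
rewrite preimage_setI proj_translate; congr (lebesgue_measure (_ `&` _)).
apply/seteqP; split=> x /=; rewrite !in_itv/= => /andP[? ?]; apply/andP; split; lra.
Qed.

Lemma measurable_arc s r : measurable [set t | circle_dist s t < r].
Proof.
suff h : measurable (@circle_proj R @^-1` [set t | circle_dist s t < r]) by exact: h.
apply: open_measurable.
have -> : @circle_proj R @^-1` [set t | circle_dist s t < r] =
    \bigcup_(m : int) ball (repr s - m%:~R) r.
  apply/seteqP; split=> x /=.
    rewrite -{1}[s]circle_projK circle_dist_proj => /dist_int_ltP[m xm].
    by exists m => //; rewrite /ball/= addrAC.
  move=> [m _]; rewrite /ball/= => xm.
  rewrite -{1}[s]circle_projK circle_dist_proj; apply/dist_int_ltP.
  by exists m; rewrite addrAC.
by apply: bigcup_open => m _; exact: ball_open.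
Qed.

(** An arc centred at 0 meets [[0, 1)] in [[0, r)] and []1 - r, 1[], which are disjoint because
    [r <= 1 / 2]. *)
Lemma circle_lebesgue_arc s r : 0 < r -> r <= 1 / 2 ->
  circle_lebesgue [set t | circle_dist s t < r] = (2 * r)%:E.
Proof.
move=> r0 r2.
have -> : [set t | circle_dist s t < r] =
    (fun t => t + (- s)) @^-1` [set t | circle_dist 0 t < r].
  apply/seteqP; split=> t /=;
    by rewrite -(circle_dist_translate s t (- s)) subrr.
rewrite circle_lebesgue_translate; last exact: measurable_arc.
rewrite /circle_lebesgue.
have -> : @circle_proj R @^-1` [set t | circle_dist 0 t < r] `&` `[0, 1[ =
    `[0, r[ `|` `]1 - r, 1[.
  apply/seteqP; split=> x /=; rewrite -(circle_proj_int R 0) circle_dist_proj !in_itv/=.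
  - move=> [/dist_int_ltP[m]]; rewrite ltr_norml => /andP[h1 h2] /andP[x0 x1].
    (* As [x] is in [[0, 1)] and [- x] is within [1 / 2] of [m], only two integers remain, one for
       each end of the interval. *)
    have : (-1 <= m <= 0).
      have : -2 < m%:~R :> R by lra.
      have : m%:~R < 1 :> R by lra.
      rewrite -[1]/(1%:~R) ltr_int; rewrite -[-2]/((-2)%:~R) ltr_int.
      by move=> ? ?; apply/andP; split; lia.
    move=> /andP[m1 m0].
    have [m00|mn0] := eqVneq m 0; [left|right].
      by apply/andP; split => //; move: h1 h2; rewrite m00; lra.
    have mE : m = -1 by lia.
    by apply/andP; split => //; move: h1 h2; rewrite mE mulrN1z; lra.
  - move=> [/andP[x0 xr]|/andP[rx x1]]; split; try (apply/andP; split; lra).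
      by apply/dist_int_ltP; exists 0; rewrite ltr_norml; apply/andP; split; lra.
    by apply/dist_int_ltP; exists (-1); rewrite mulrN1z ltr_norml; apply/andP; split; lra.
rewrite measureU//; last first.
  rewrite -subset0 => x/= []; rewrite !in_itv/= => /andP[? ?] /andP[? ?]; lra.
rewrite -[LHS]/(lebesgue_measure [set` `[0%R, r[%R] +
  lebesgue_measure [set` `]1 - r, 1[%R])%E.
rewrite !lebesgue_measure_itv/= !lte_fin r0 gtrBl r0 -EFinB -EFinD.
by congr EFin; lra.
Qed.

(** Beyond [1 / 2] the bound exceeds the total mass. *)
Lemma circle_lebesgue_arc_le s r : 0 < r ->
  (circle_lebesgue [set t | (circle_dist s t < r)%R] <= (2 * r)%:E)%E.
Proof.
move=> r0; have [r2|r2] := leP r (1 / 2); first by rewrite circle_lebesgue_arc.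
apply: (le_trans (@probability_le1 _ _ _ (@circle_lebesgue R) _ (measurable_arc s r))).
by rewrite lee_fin; lra.
Qed.

End circle_lebesgue.

(** * Invariance of product measures *)

Section fiberwise.
Context d1 d2 (T1 : measurableType d1) (T2 : measurableType d2) (R : realType).
Variable m1 : {measure set T1 -> \bar R}.
Variable m2 : {sigma_finite_measure set T2 -> \bar R}.

(** The section at [x] of the preimage of [A] is the preimage under [h x] of the section of [A] at
    [f x]. Invariance on the fibres removes [h x], then invariance on the base removes [f]. This
    serves both the skew product and the pair map formed by two iterates. *)
Lemma invariant_measure_fiberwise (f : T1 -> T1) (h : T1 -> T2 -> T2) :
  measurable_fun [set: T1] f ->
  measurable_fun [set: T1 * T2] (fun z => (f z.1, h z.1 z.2)) ->
  invariant_measure f m1 -> (forall x, invariant_measure (h x) m2) ->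
  invariant_measure (fun z => (f z.1, h z.1 z.2)) (m1 \x m2)%E.
Proof.
move=> mf mF if1 ih A mA; rewrite /product_measure1.
have mxA := measurable_fun_xsection m2 mA.
transitivity (\int[m1]_x ((m2 \o xsection A) \o f) x)%E.
  apply: eq_integral => x _ /=.
  by rewrite -[in RHS](ih x) ?xsectionE//; rewrite -?xsectionE; exact: measurable_xsection.
have -> : [set: T1] = f @^-1` [set: T1] by rewrite preimage_setT.
rewrite -ge0_integral_pushforward//.
pose pf : {mfun T1 >-> T1} := HB.pack f (isMeasurableFun.Build _ _ _ _ _ mf).
have := @eq_measure_integral _ _ _ setT m1 (pushforward m1 pf) (m2 \o xsection A).
by apply => B mB _; exact: if1.
Qed.

End fiberwise.

Lemma invariant_measure_iter d (T : measurableType d) (R : realType)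
    (m : set T -> \bar R) (f : T -> T) (n : nat) :
  measurable_fun [set: T] f -> invariant_measure f m ->
  measurable_fun [set: T] (iter n f) /\ invariant_measure (iter n f) m.
Proof.
move=> mf If; elim: n => [|n [mn In]]; first by split => //; exact: measurable_id.
split; first exact: (measurableT_comp mf mn).
move=> A mA; rewrite -(If _ mA) -(In (f @^-1` A))//.
by rewrite -[X in measurable X]setTI; exact: mf.
Qed.

(** * Measurability of distances on separable spaces *)

Section dense_sequence.
Context d (T : measurableType d) (R : realType) (dist : T -> T -> R).
Variable c : nat -> T.
Hypothesis dist_triangle : forall y x z, dist x z <= dist x y + dist y z.
Hypothesis distC : forall x y, dist x y = dist y x.
Hypothesis c_dense : forall x e, 0 < e -> exists n, dist (c n) x < e.
Hypothesis measurable_dist_ball : forall x r, measurable [set y | dist x y < r].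

(** A nearby point of the dense sequence decouples [x] from [y], so that the set is a countable
    union of measurable rectangles. *)
Lemma measurable_dist_lt r : measurable [set z : T * T | dist z.1 z.2 < r].
Proof.
have -> : [set z : T * T | dist z.1 z.2 < r] =
    \bigcup_n \bigcup_m ([set x | dist (c n) x < m.+1%:R^-1] `*`
                         [set y | dist (c n) y < r - m.+1%:R^-1]).
  apply/seteqP; split => [[x y] /= xyr|[x y] /= [n _ [m _ [/= xn ny]]]]; last first.
    apply: le_lt_trans (dist_triangle (c n) _ _) _; rewrite distC.
    by rewrite -(subrKC m.+1%:R^-1 r) ltrD.
  (* Half the gap, because [1 / m.+1] is spent twice: in moving from [x] to [c n], and in the
     reduced radius around [c n]. *)
  have e0 : 0 < (r - dist x y) / 2 by rewrite divr_gt0// subr_gt0.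
  pose m := Num.truncn ((r - dist x y) / 2)^-1.
  have mE : m.+1%:R^-1 < (r - dist x y) / 2.
    by rewrite -[ltRHS]invrK ltf_pV2 ?posrE ?invr_gt0 ?truncnS_gt.
  have [n nx] := @c_dense x m.+1%:R^-1 (ltac:(by rewrite invr_gt0)).
  exists n => //; exists m => //; split => //=.
  by move: mE nx (dist_triangle x (c n) y); move: m.+1%:R^-1 => u; lra.
by do 2 (apply: bigcupT_measurable => ?); apply: measurableX.
Qed.

End dense_sequence.

(** * Almost sure statements from bounds on measures *)

Section borel_cantelli.
Context d (T : measurableType d) (R : realType).
Variable P : {measure set T -> \bar R}.

Lemma borel_cantelli_geometric (F : (set T)^nat) (K q : R) :
  (forall k, measurable (F k)) -> 0 < q < 1 -> 0 <= K ->
  (\forall k \near \oo, (P (F k) <= (K * q ^+ k)%:E)%E) ->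
  {ae P, forall x, \forall k \near \oo, ~ F k x}.
Proof.
move=> mF /andP[q0 q1] K0 [N _ NF].
(* The bound holds only from [N] on; after the shift every term is dominated by the geometric
   series. *)
pose G k := F (k + N)%N.
have PG : P (lim_sup_set G) = 0%E.
  apply: lim_sup_set_cvg0 => [k|]; first exact: mF.
  apply: (@le_lt_trans _ _ (K * (1 - q)^-1)%:E); last exact: ltry.
  apply: lime_le; first exact: is_cvg_nneseries.
  apply: nearW => n; apply: le_trans (_ : _ <= (series (geometric K q) n)%:E)%E _.
    rewrite /series/= -sumEFin; apply: lee_sum => k _.
    apply: le_trans (NF _ (leq_addl k N)) _; rewrite lee_fin ler_wpM2l//.
    by rewrite exprD ler_piMr ?exprn_ge0 ?exprn_ile1 ?ltW.
  by rewrite lee_fin geometric_le_lim// gtr0_norm.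
exists (lim_sup_set G); split => //.
- apply: bigcap_measurable => // n _; apply: bigcup_measurable => k _; exact: mF.
- move=> x /= nx n _; apply: contrapT => nG; apply: nx.
  exists (n + N)%N => // k /= nk Fk; apply: nG.
  have Nk : (N <= k)%N by apply: leq_trans nk; exact: leq_addl.
  exists (k - N)%N; last by rewrite /G subnK.
  by rewrite /= leq_subRL// addnC.
Qed.

(** The points lying in all [F k] with [k >= N] lie in each one of them, and these have arbitrarily
    small measure; no summability is involved. *)
Lemma ae_frequently (F : (set T)^nat) :
  (forall k, measurable (F k)) ->
  (forall (e : R) N, 0 < e -> exists2 k, (N <= k)%N & (P (F k) <= e%:E)%E) ->
  {ae P, forall x, forall N, exists2 k, (N <= k)%N & ~ F k x}.
Proof.
move=> mF PF; apply/ae_foralln => N.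
exists (\bigcap_(k in [set k | (N <= k)%N]) F k); split.
- by apply: bigcap_measurable => [|k _]; [exists N => /=|exact: mF].
- apply/le_anti; rewrite measure_ge0 andbT; apply/lee_addgt0Pr => e e0; rewrite add0e.
  have [k Nk] := PF e N e0; apply: le_trans; apply: le_measure.
  + by rewrite inE; apply: bigcap_measurable => [|j _]; [exists N => /=|exact: mF].
  + by rewrite inE.
  + exact: bigcap_inf.
- move=> x /= nx k /= Nk; apply: contrapT => nF; apply: nx.
  by exists k.
Qed.

(** The values [e = 1 / n.+1] suffice, so that the exceptional sets, one for each [e], merge into a
    countable union. *)
Lemma ae_le_inf (u : T -> \bar R) (l : R) :
  (forall e : R, 0 < e -> {ae P, forall x, (u x <= (l + e)%:E)%E}) ->
  {ae P, forall x, (u x <= l%:E)%E}.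
Proof.
move=> ul.
have : {ae P, forall x, forall n : nat, (u x <= (l + n.+1%:R^-1)%:E)%E}.
  by apply/ae_foralln => n; apply: ul; rewrite invr_gt0.
apply: filterS => x ux; apply/lee_addgt0Pr => e e0.
pose m := Num.truncn e^-1.
apply: le_trans (ux m) _; rewrite -EFinD lee_fin lerD2l ltW//.
by rewrite -[ltRHS]invrK ltf_pV2 ?posrE ?invr_gt0 ?truncnS_gt.
Qed.

End borel_cantelli.

(** * Borel sets, dense sequences and cylinders *)

Section metric_borel.
Context d (R : realType) (Omega : borelMetricType d R).

Lemma measurable_open (U : set Omega) : open U -> measurable U.
Proof. by move=> oU; rewrite measurable_borel; exact: sub_sigma_algebra. Qed.

Lemma measurable_closed (F : set Omega) : closed F -> measurable F.
Proof.
by move=> cF; rewrite -[F]setCK; apply/measurableC/measurable_open/closed_openC.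
Qed.

Lemma measurable_mdist_ball (x : Omega) r : measurable [set y | mdist x y < r].
Proof.
apply: measurable_open; rewrite openE => y /= xyr; apply/nbhs_ballP.
exists (r - mdist x y); rewrite /= ?subr_gt0//.
move=> z; rewrite ballEmdist/= => yz.
by apply: le_lt_trans (metric_triangle x y z) _; lra.
Qed.

Lemma second_countable_dense_sequence : @second_countable Omega ->
  exists c : nat -> Omega,
    forall x e, 0 < e -> exists n, mdist (c n) x < e.
Proof.
move=> [B /countable_injP[f finj] [Bo Bb]].
(* A point of the basic open set with code [n]; the default [point] is returned when no nonempty
   basic set has this code. *)
exists (fun n => xget point [set x | exists U, [/\ B U, f U = n & U x]]) => x e e0.
have [U /= [BU Ux] Ue] := Bb x _ (nbhsx_ballx x e e0).
exists (f U); case: xgetP => [y _ [V [BV fVU Vy]]|/(_ x)[]]; last by exists U.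
have VU : V = U by apply: finj; rewrite ?inE.
by rewrite metric_sym; have := Ue y; rewrite -VU ballEmdist; apply.
Qed.

End metric_borel.

Lemma circle_dense_sequence (R : realType) :
  exists c : nat -> circle R,
    forall x e, 0 < e -> exists n, circle_dist (c n) x < e.
Proof.
exists (fun n => circle_proj (ratr (odflt 0 (unpickle n)) : R)) => x e e0.
have [q] : exists q : rat, ratr q \in `]repr x, (repr x + e)[.
  by apply: rat_in_itvoo; rewrite ltrDl.
rewrite in_itv/= => /andP[q1 q2]; exists (pickle q).
rewrite pickleK/= -{1}[x]circle_projK circle_dist_proj.
apply: le_lt_trans (dist_int_le _ 0) _; rewrite subr0 ltr_norml.
by apply/andP; split; lra.
Qed.

Lemma measurable_circle_dist_lt (R : realType) (r : R) :
  measurable [set z : circle R * circle R | circle_dist z.1 z.2 < r].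
Proof.
have [c cd] := circle_dense_sequence R.
apply: (measurable_dist_lt _ _ cd).
- exact: circle_dist_triangle.
- exact: circle_distC.
- exact: measurable_arc.
Qed.

Lemma measurable_mdist_lt d (R : realType) (Omega : borelMetricType d R) (r : R) :
  @second_countable Omega ->
  measurable [set z : Omega * Omega | mdist z.1 z.2 < r].
Proof.
move=> /second_countable_dense_sequence[c cd].
apply: (measurable_dist_lt _ _ cd).
- by move=> y x z; exact: metric_triangle.
- exact: metric_sym.
- exact: measurable_mdist_ball.
Qed.

(** There are countably many words, so the union is countable for any [W]; each cylinder is an
    intersection of preimages of closed sets. *)
Lemma measurable_cylinder_union d (R : realType) (Omega : borelMetricType d R)
    (T : Omega -> Omega) p (J : 'I_p -> set Omega) (W : set (seq 'I_p)) :
  measurable_fun [set: Omega] T -> (forall i, closed (J i)) ->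
  measurable (cylinder_union T J W).
Proof.
move=> mT cJ.
have mTk k : measurable_fun [set: Omega] (iter k T).
  by elim: k => [|k IH]; [exact: measurable_id|exact: (measurableT_comp mT IH)].
rewrite /cylinder_union bigcup_mkcond.
apply: countable_bigcupT_measurable => [|w]; first exact: countableP.
case: ifPn => // _.
have -> : cylinder T J w =
    \bigcap_k (if onth w k is Some i then iter k T @^-1` J i else setT).
  apply/seteqP; split=> x /= wx k; first by case E: (onth w k) => [i|//] _; exact: wx E.
  by move=> i wk; have := wx k Logic.I; rewrite wk.
apply: bigcapT_measurable => k; case: onth => // i.
rewrite -[X in measurable X]setTI; apply: mTk => //.
exact/measurable_closed/cJ.
Qed.

(** * The skew product: measurability, invariance, iterates *)

Section skew_product.
Context d (R : realType) (Omega : borelMetricType d R).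
Variables (T : Omega -> Omega) (alpha : R) (I : set Omega).
Variable mu : probability Omega R.
Hypothesis mT : measurable_fun [set: Omega] T.
Hypothesis mI : measurable I.
Hypothesis muT : invariant_measure T mu.
Let S := skew_product T alpha I.

Lemma measurable_skew_dist_lt (r : R) : @second_countable Omega ->
  measurable [set z : (Omega * circle R) * (Omega * circle R) |
                skew_dist z.1 z.2 < r].
Proof.
move=> sc.
have -> : [set z : (Omega * circle R) * (Omega * circle R) |
      skew_dist z.1 z.2 < r] =
    (fun z => (z.1.1, z.2.1)) @^-1` [set z | mdist z.1 z.2 < r] `&`
    (fun z => (z.1.2, z.2.2)) @^-1` [set z | circle_dist z.1 z.2 < r].
  apply/seteqP; split=> z /=; rewrite /skew_dist gt_max; first by move=> /andP.
  by move=> ?; apply/andP.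
apply: measurableI; rewrite -[X in measurable X]setTI.
  have : measurable_fun [set: (Omega * circle R) * (Omega * circle R)]
      (fun z => (z.1.1, z.2.1)).
    by apply: measurable_fun_pair; exact: measurableT_comp.
  by apply => //; exact: measurable_mdist_lt.
have : measurable_fun [set: (Omega * circle R) * (Omega * circle R)]
    (fun z => (z.1.2, z.2.2)).
  by apply: measurable_fun_pair; exact: measurableT_comp.
by apply => //; exact: measurable_circle_dist_lt.
Qed.

Lemma measurable_skew_product : measurable_fun [set: Omega * circle R] S.
Proof.
apply: measurable_fun_pair; first exact: measurableT_comp.
move=> _ A mA; rewrite setTI.
have mtr c : measurable ((fun t => t + c) @^-1` A).
  by rewrite -[X in measurable X]setTI; exact: measurable_circle_translate.
(* The angle takes two values, so the map is a constant rotation over [I] and another one over its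
   complement. *)
have -> : (fun x : Omega * circle R => x.2 + circle_proj (alpha * \1_I x.1)) @^-1` A =
    (I `*` (fun t => t + circle_proj alpha) @^-1` A) `|`
    (~` I `*` (fun t => t + circle_proj 0) @^-1` A).
  apply/seteqP; split=> -[w t] /=.
    rewrite indicE; case: (boolP (w \in I)); rewrite (inE, notin_setE) => Iw.
      by rewrite mulr1; left.
    by rewrite mulr0; right.
  move=> [[Iw At]|[nIw At]]; rewrite indicE.
    by rewrite mem_set// mulr1.
  by rewrite memNset// mulr0.
by apply: measurableU; apply: measurableX => //; exact: measurableC.
Qed.

Lemma skew_measure_invariant : invariant_measure S (skew_measure mu).
Proof.
have := @invariant_measure_fiberwise _ _ _ _ _ mu (@circle_lebesgue R) T
  (fun w t => t + circle_proj (alpha * \1_I w)) mT measurable_skew_product muT.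
by apply => w A mA; exact: circle_lebesgue_translate.
Qed.

(** The number [k] counts the visits of the base orbit to [I] before time [n]; the later union
    bounds use only [k <= n]. *)
Lemma iter_skew_product_snd n x :
  exists2 k, (k <= n)%N & (iter n S x).2 = x.2 + circle_proj (k%:R * alpha).
Proof.
elim: n => [|n [k kn IH]].
  by exists 0%N => //=; rewrite mul0r (circle_proj_int R 0) addr0.
exists (k + ((iter n S x).1 \in I))%N.
  by rewrite -addn1 leq_add// leq_b1.
by rewrite [LHS]/= IH -addrA -circle_projD indicE natrD mulrDl (mulrC alpha).
Qed.

End skew_product.

(** * Correlation integrals and correlation dimension *)

Section correlation_integral.
Context d (E : measurableType d) (R : realType) (dist : E -> E -> R).
Variable m : probability E R.

Definition correlation_integral (r : R) : \bar R :=
  (\int[m]_x m [set y | (dist x y < r)%R])%E.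

Lemma correlation_integral_product r :
  correlation_integral r = (m \x m)%E [set z | dist z.1 z.2 < r].
Proof.
apply: eq_integral => x _ /=; congr (m _).
by apply/seteqP; split=> y; rewrite xsectionE.
Qed.

Hypothesis measurable_dist_lt :
  forall r, measurable [set z : E * E | dist z.1 z.2 < r].

Lemma correlation_integral_le1 r : (correlation_integral r <= 1)%E.
Proof.
rewrite correlation_integral_product.
exact: (@probability_le1 _ _ _ (m \x m)%E).
Qed.

Lemma correlation_integral_ge0 r : (0 <= correlation_integral r)%E.
Proof. by rewrite correlation_integral_product measure_ge0. Qed.

Lemma correlation_integral_fin_num r : correlation_integral r \is a fin_num.
Proof.
rewrite ge0_fin_numE; last exact: correlation_integral_ge0.
by apply: le_lt_trans (correlation_integral_le1 r) _; exact: ltry.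
Qed.

Lemma correlation_integral_fine r :
  (fine (correlation_integral r))%:E = correlation_integral r.
Proof. by rewrite fineK//; exact: correlation_integral_fin_num. Qed.

Lemma fine_correlation_integral_le1 r : fine (correlation_integral r) <= 1.
Proof.
by rewrite -lee_fin correlation_integral_fine correlation_integral_le1.
Qed.

Lemma correlation_dimension_ge0 (C : R) :
  is_correlation_dimension dist m C -> 0 <= C.
Proof.
move=> hC; apply: (cvgr_to_ge hC); near=> r.
have r1 : r < 1 by near: r; exact: nbhs_right_lt.
rewrite -mulrNN mulr_ge0// oppr_ge0.
  exact/ln_le0/fine_correlation_integral_le1.
by rewrite invr_le0; apply/ln_le0/ltW.
Unshelve. all: by end_near. Qed.

(** Near 0 the quotient of logarithms exceeds [s]. Multiplying by [ln r < 0] reverses the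
    inequality, and positivity allows both logarithms to be removed. *)
Lemma correlation_integral_le_powR (C s : R) :
  is_correlation_dimension dist m C -> s < C ->
  (forall r, 0 < r -> (0 < correlation_integral r)%E) ->
  \forall r \near 0^'+, (correlation_integral r <= (r `^ s)%:E)%E.
Proof.
move=> hC sC cpos; near=> r.
have r1 : r < 1 by near: r; exact: nbhs_right_lt.
have r0 : 0 < r by near: r; exact: nbhs_right_gt.
have h : s < ln (fine (correlation_integral r)) / ln r.
  by near: r; exact: cvgr_gt hC _ sC.
have c0 : 0 < fine (correlation_integral r).
  by rewrite -lte_fin correlation_integral_fine cpos.
rewrite -correlation_integral_fine lee_fin -ler_ln ?posrE ?powR_gt0//.
rewrite ln_powR -ler_ndivlMr ?ltW//.
by rewrite ln_lt0// r0.
Unshelve. all: by end_near. Qed.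

Hypothesis separable : exists c : nat -> E,
  forall x e, 0 < e -> exists n, dist (c n) x < e.
Hypothesis dist_triangle : forall y x z, dist x z <= dist x y + dist y z.
Hypothesis distC : forall x y, dist x y = dist y x.

(** Countably many balls of radius [r / 2] cover the space, so one of them has positive measure, and
    any two of its points are at distance less than [r]. *)
Lemma correlation_integral_gt0 r : 0 < r -> (0 < correlation_integral r)%E.
Proof.
move=> r0; have [c cd] := separable.
have r2 : 0 < r / 2 by rewrite divr_gt0.
pose B n := [set y | dist (c n) y < r / 2].
have mB n : measurable (B n).
  rewrite [B n](_ : _ = xsection [set z : E * E | dist z.1 z.2 < r / 2] (c n)).
    exact: measurable_xsection.
  by apply/seteqP; split=> y; rewrite xsectionE.
have [n Bn] : exists n, (0 < m (B n))%E.
  apply: contrapT => /forallNP nB.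
  have : (m setT <= \sum_(n <oo) m (B n))%E.
    apply: measure_sigma_subadditive => //.
    by move=> x _; have [n xn] := cd x _ r2; exists n.
  rewrite probability_setT eseries0 ?lee_fin ?ler10// => n _ _.
  by apply/le_anti; rewrite measure_ge0 andbT leNgt; apply/negP/nB.
apply: (@lt_le_trans _ _ ((m \x m)%E (B n `*` B n))).
  by rewrite product_measure1E// mule_gt0.
rewrite correlation_integral_product; apply: le_measure; rewrite ?inE//.
  exact: measurableX.
move=> [x y] [/= nx ny]; apply: le_lt_trans (dist_triangle (c n) _ _) _.
by rewrite distC (splitr r) ltrD.
Qed.

End correlation_integral.

(** * The correlation dimension of the skew product *)

Section skew_correlation.
Context d (R : realType) (Omega : borelMetricType d R).
Variable mu : probability Omega R.
Hypothesis sc : @second_countable Omega.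
Let nu := skew_measure mu.
Let ci := correlation_integral (@mdist R Omega) mu.
Let skew_ci := correlation_integral (@skew_dist d R Omega) nu.

Let mmd r := measurable_mdist_lt r sc.
Let msd r := measurable_skew_dist_lt r sc.

Lemma skew_measure_fst (A : set Omega) : measurable A ->
  nu (fst @^-1` A) = mu A.
Proof.
move=> mA; have -> : fst @^-1` A = A `*` [set: circle R].
  by apply/seteqP; split=> [[x y]|[x y] []].
rewrite /nu /skew_measure product_measure1E// -[RHS]mule1; congr (_ * _)%E.
exact: (@probability_setT _ _ _ (@circle_lebesgue R)).
Qed.

(** A ball for the sup distance is a ball of the base times an arc, whose measure [2 r] does not
    depend on the centre and leaves the integral. *)
Lemma skew_correlation_integral r : 0 < r -> r <= 1 / 2 ->
  skew_ci r = (ci r * (2 * r)%:E)%E.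
Proof.
move=> r0 r2; rewrite /skew_ci /correlation_integral.
pose g x : \bar R := mu [set w | mdist x w < r].
have mg : measurable_fun [set: Omega] g.
  have := measurable_fun_xsection mu (mmd r).
  congr (measurable_fun _ _); apply/funext => x; rewrite /g/=; congr (mu _).
  by apply/seteqP; split=> y; rewrite xsectionE.
have g0 x : (0 <= g x)%E by exact: measure_ge0.
transitivity (\int[nu]_x ((fun w => g w * (2 * r)%:E) \o fst) x)%E.
  apply: eq_integral => x _ /=; rewrite /g.
  rewrite -(circle_lebesgue_arc x.2 r0 r2) -product_measure1E; first last.
  - exact: measurable_arc.
  - exact: measurable_mdist_ball.
  congr (_ _); apply/seteqP; split=> -[w t] /=; rewrite /skew_dist gt_max/=.
    by move=> /andP.
  by move=> ?; apply/andP.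
have mfst : measurable_fun [set: Omega * circle R] fst by exact: measurable_fst.
have -> : [set: Omega * circle R] = fst @^-1` [set: Omega] by [].
rewrite -ge0_integral_pushforward//; first last.
- by move=> x _; rewrite mule_ge0// lee_fin mulr_ge0// ltW.
- by apply: emeasurable_funM => //; exact: measurable_cst.
pose pf : {mfun (Omega * circle R)%type >-> Omega} :=
  HB.pack fst (isMeasurableFun.Build _ _ _ _ _ mfst).
transitivity (\int[mu]_x (g x * (2 * r)%:E))%E.
  apply: (@eq_measure_integral _ _ _ _ mu (pushforward nu pf)) => A mA _.
  exact: skew_measure_fst.
by rewrite ge0_integralZr// lee_fin mulr_ge0// ltW.
Qed.

Lemma mdist_correlation_integral_gt0 r : 0 < r -> (0 < ci r)%E.
Proof.
apply: correlation_integral_gt0 => //.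
- exact: second_countable_dense_sequence.
- by move=> y x z; exact: metric_triangle.
- exact: metric_sym.
Qed.

(** The factor [2 r] contributes [1 + ln 2 / ln r] to the quotient, and this tends to 1. *)
Lemma skew_correlation_dimension C :
  is_correlation_dimension (@mdist R Omega) mu C ->
  is_correlation_dimension (@skew_dist d R Omega) nu (C + 1).
Proof.
move=> hC.
have l2 : ln 2 / ln r @[r --> (0:R)^'+] --> (0 : R).
  rewrite -[X in _ --> X](mulr0 (ln 2)); apply: cvgMl_tmp.
  apply/ltr0_cvgV0; last exact: lnNy.
  near=> r; apply: ln_lt0; apply/andP; split; near: r.
    exact: nbhs_right_gt.
  exact: nbhs_right_lt.
have : 1 + (ln 2 / ln r + ln (fine (ci r)) / ln r) @[r --> (0:R)^'+] --> C + 1.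
  rewrite addrC -[X in 1 + X]add0r.
  by apply: cvgD; [exact: cvg_cst|exact: cvgD].
apply: cvg_trans; apply: near_eq_cvg; near=> r.
have r0 : 0 < r by near: r; exact: nbhs_right_gt.
have r2 : r < 1 / 2 by near: r; apply: nbhs_right_lt; rewrite divr_gt0.
rewrite -[X in _ = ln (fine X) / _]/(skew_ci r) skew_correlation_integral ?ltW//.
have c0 : 0 < fine (ci r).
  by rewrite -lte_fin correlation_integral_fine// mdist_correlation_integral_gt0.
have ciE : (fine (ci r))%:E = ci r by exact: correlation_integral_fine.
rewrite -[in RHS]ciE -EFinM [fine _%:E]/=.
rewrite !lnM ?posrE ?mulr_gt0//.
have : ln r < 0 by rewrite ln_lt0// r0/=; lra.
by move=> lr0; field; rewrite lt_eqF.
Unshelve. all: by end_near. Qed.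

Lemma skew_correlation_integral_le (C s : R) :
  is_correlation_dimension (@mdist R Omega) mu C -> s < C + 1 ->
  \forall r \near 0^'+, (skew_ci r <= (r `^ s)%:E)%E.
Proof.
move=> /skew_correlation_dimension hC sC.
apply: (correlation_integral_le_powR msd hC sC) => r r0.
(* The product formula covers radii up to [1 / 2]; positivity at larger [r] follows by
   monotonicity. *)
pose e := Num.min r (1 / 2).
have e0 : 0 < e by rewrite lt_min r0 divr_gt0.
have e2 : e <= 1 / 2 by rewrite ge_min lexx orbT.
apply: (@lt_le_trans _ _ (skew_ci e)).
  rewrite skew_correlation_integral// mule_gt0 ?mdist_correlation_integral_gt0//.
  by rewrite lte_fin mulr_gt0.
rewrite /skew_ci (@correlation_integral_product _ _ R skew_dist (skew_measure mu) e).
rewrite (@correlation_integral_product _ _ R skew_dist (skew_measure mu) r).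
apply: le_measure; rewrite ?inE; [exact: msd|exact: msd|].
move=> z /= /lt_le_trans; apply.
by rewrite ge_min lexx.
Qed.

End skew_correlation.

(** * From bounds on measures to almost sure logarithmic rates *)

Lemma powR_eventually_lt (R : realType) (a e : R) : 0 < a -> 0 < e ->
  exists N, forall n, (N <= n)%N -> n%:R `^ (- a) < e.
Proof.
move=> a0 e0; pose N := Num.truncn (e^-1 `^ a^-1).
exists N.+1 => n Nn; rewrite powRN -[ltRHS]invrK ltf_pV2 ?posrE; first last.
- by rewrite invr_gt0.
- by rewrite powR_gt0// ltr0n (leq_ltn_trans _ Nn).
have -> : e^-1 = (e^-1 `^ a^-1) `^ a.
  by rewrite -powRrM mulVf ?gt_eqF// powRr1// invr_ge0 ltW.
apply: gt0_ltr_powR => //; rewrite ?nnegrE ?powR_ge0 ?ler0n//.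
by apply: lt_le_trans (truncnS_gt _) _; rewrite ler_nat.
Qed.

Section probability_bounds.
Context d (T : measurableType d) (R : realType).
Variable P : {measure set T -> \bar R}.

Lemma measure_le_sum_cover (A : (set T)^nat) (E : set T) (n : nat) (p : R) :
  measurable E -> (forall i, measurable (A i)) ->
  (forall i, (i < n)%N -> (P (A i) <= p%:E)%E) ->
  (forall x, E x -> exists2 i, (i < n)%N & A i x) ->
  (P E <= (n%:R * p)%:E)%E.
Proof.
move=> mE mA PA EA.
apply: (@le_trans _ _ (P (\big[setU/set0]_(i < n) A i))).
  apply: le_measure; rewrite ?inE//; first exact: bigsetU_measurable.
  by move=> x /EA[i ni Aix]; rewrite -bigcup_mkord; exists i.
apply: le_trans (Boole_inequality _ _) _ => //.
rewrite mulr_natl -[X in (_ *+ X)%R]card_ord -sumr_const -sumEFin.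
by apply: lee_sum => i _; exact: PA.
Qed.

Variable M : T -> nat -> \bar R.
Hypothesis M_anti : forall x m n, (m <= n)%N -> (M x n <= M x m)%E.
Hypothesis measurable_M_lt :
  forall n (r : R), measurable [set x | (M x n < r%:E)%E].

(** Any [c > 0] is enough: at [n = 2^k] the bound is geometric with ratio [2^-c]. Interpolation
    between powers of two costs an arbitrarily small increase of [a]. *)
Lemma ae_limn_esup_log_le (a c K : R) : 0 <= a -> 0 < c -> 0 <= K ->
  (\forall n \near \oo,
    (P [set x | (M x n < (n%:R `^ (- a))%:E)%E] <= (K * n%:R `^ (- c))%:E)%E) ->
  {ae P, forall x, (limn_esup (fun n => lne (M x n) / (- ln n%:R)%:E) <= a%:E)%E}.
Proof.
move=> a0 c0 K0 [N _ NP].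
pose F k := [set x | (M x (2 ^ k) < ((2 ^ k)%:R `^ (- a))%:E)%E].
have q01 : 0 < (2 : R) `^ (- c) < 1.
  rewrite powR_gt0//= /powR pnatr_eq0/= expR_lt1 mulNr oppr_lt0 mulr_gt0//.
  by rewrite ln_gt0// ltr1n.
have : {ae P, forall x, \forall k \near \oo, ~ F k x}.
  apply: (@borel_cantelli_geometric _ _ _ _ F K (2 `^ (- c))) => //.
    by move=> k; exact: measurable_M_lt.
  exists N => // k /= Nk; apply: le_trans (NP (2 ^ k)%N _) _.
    by apply: leq_trans Nk _; apply: ltnW; exact: ltn_expl.
  by rewrite natrX -powR_mulrn// -powRrM [_ * - c]mulrC powRrM powR_mulrn ?powR_ge0.
apply: filterS => x xF; apply/lee_addgt0Pr => e e0; rewrite -EFinD.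
apply: (@limn_esup_log_le_dyadic _ _ a) => //; first by move=> m n; exact: M_anti.
  by rewrite ltrDl.
by apply: filterS xF => k /negP; rewrite -leNgt.
Qed.

Lemma ae_limn_einf_log_le (a : R) :
  (forall (e : R) N, 0 < e -> exists2 n, (N <= n)%N &
    (P [set x | (M x n < (n%:R `^ (- a))%:E)%E] <= e%:E)%E) ->
  {ae P, forall x, (limn_einf (fun n => lne (M x n) / (- ln n%:R)%:E) <= a%:E)%E}.
Proof.
move=> PM; pose F n := [set x | (M x n < (n%:R `^ (- a))%:E)%E].
have : {ae P, forall x, forall N, exists2 n, (N <= n)%N & ~ F n x}.
  by apply: ae_frequently => // n; exact: measurable_M_lt.
apply: filterS => x xF; apply: limn_einf_le_frequently => N.
have [n] := xF (maxn 2 N); rewrite geq_max => /andP[n2 Nn] /negP.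
by rewrite -leNgt => Mn; exists n => //; exact: log_ratio_le.
Qed.

End probability_bounds.

(** * The shortest distance between two orbits *)

Section shortest_distance.
Context (R : realType) (E : Type) (dist : E -> E -> R) (S : E -> E).

Lemma shortest_distance_geP (n : nat) (x y : E) (r : \bar R) :
  (r <= shortest_distance dist S n x y)%E <->
  forall i j, (i < n)%N -> (j < n)%N -> (r <= (dist (iter i S x) (iter j S y))%:E)%E.
Proof.
split=> [/bigmin_geP[_ h] i j ni nj|h].
  have /bigmin_geP[_] := h (Ordinal ni) isT.
  by move=> /(_ (Ordinal nj) isT).
apply/bigmin_geP; split=> [|i _]; first exact: leey.
by apply/bigmin_geP; split=> [|j _]; [exact: leey|exact: h].
Qed.

Lemma shortest_distance_anti (x y : E) (m n : nat) : (m <= n)%N ->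
  (shortest_distance dist S n x y <= shortest_distance dist S m x y)%E.
Proof.
move=> mn; apply/shortest_distance_geP => i j im jm.
have [+ _] := shortest_distance_geP n x y (shortest_distance dist S n x y).
by apply; rewrite ?lexx// (leq_trans _ mn).
Qed.

Lemma shortest_distance_ltP (n : nat) (x y : E) (r : R) :
  (shortest_distance dist S n x y < r%:E)%E <->
  exists i j, [/\ (i < n)%N, (j < n)%N & dist (iter i S x) (iter j S y) < r].
Proof.
split=> [|[i [j [ni nj xy]]]].
  apply: contraPP => h; apply/negP; rewrite -leNgt.
  apply/shortest_distance_geP => i j ni nj; rewrite lee_fin leNgt.
  by apply/negP => xy; apply: h; exists i, j.
apply: (@le_lt_trans _ _ (dist (iter i S x) (iter j S y))%:E).
  have [+ _] := shortest_distance_geP n x y (shortest_distance dist S n x y).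
  by apply; rewrite ?lexx.
by rewrite lte_fin.
Qed.

End shortest_distance.

(** * The probability of a small shortest distance *)

Section skew_shortest_distance.
Context d (R : realType) (Omega : borelMetricType d R).
Variables (T : Omega -> Omega) (alpha : R) (I : set Omega).
Variable mu : probability Omega R.
Hypothesis mT : measurable_fun [set: Omega] T.
Hypothesis mI : measurable I.
Hypothesis muT : invariant_measure T mu.
Hypothesis sc : @second_countable Omega.
Local Notation M := (Omega * circle R)%type.
Let S := skew_product T alpha I.
Let nu := skew_measure mu.
Let P := (nu \x nu)%E.
Let D := @shortest_distance R M skew_dist S.

Lemma measurable_pair_iter i j :
  measurable_fun [set: M * M] (fun z => (iter i S z.1, iter j S z.2)).
Proof.
have mS := measurable_skew_product alpha mT mI.
have mSk k : measurable_fun [set: M] (iter k S).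
  by elim: k => [|k IH]; [exact: measurable_id|exact: (measurableT_comp mS IH)].
by apply: measurable_fun_pair; exact: measurableT_comp.
Qed.

Lemma measurable_iter_dist_lt i j r :
  measurable [set z : M * M | skew_dist (iter i S z.1) (iter j S z.2) < r].
Proof.
have := measurable_pair_iter i j measurableT (measurable_skew_dist_lt r sc).
by rewrite setTI.
Qed.

(** The pair of iterates preserves [nu \x nu], as a fibred map whose fibre map is the same over
    every point. *)
Lemma measure_iter_dist_lt i j r :
  P [set z : M * M | skew_dist (iter i S z.1) (iter j S z.2) < r] =
  correlation_integral skew_dist nu r.
Proof.
have mS := measurable_skew_product alpha mT mI.
have iS := @skew_measure_invariant _ _ _ T alpha I mu mT mI muT.
have [mSi iSi] := invariant_measure_iter i mS iS.
have [_ iSj] := invariant_measure_iter j mS iS.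
rewrite correlation_integral_product.
have := @invariant_measure_fiberwise _ _ _ _ R nu nu (iter i S)
  (fun _ => iter j S) mSi (measurable_pair_iter i j) iSi (fun _ => iSj).
by apply; exact: measurable_skew_dist_lt.
Qed.

Lemma measurable_shortest_distance_lt n (r : R) :
  measurable [set z : M * M | (D n z.1 z.2 < r%:E)%E].
Proof.
have -> : [set z : M * M | (D n z.1 z.2 < r%:E)%E] =
    \bigcup_(i in [set i | (i < n)%N]) \bigcup_(j in [set j | (j < n)%N])
      [set z : M * M | skew_dist (iter i S z.1) (iter j S z.2) < r].
  apply/seteqP; split=> z /=.
    by move/shortest_distance_ltP => [i [j [? ? ?]]]; exists i => //; exists j.
  by move=> [i /= ? [j /= ? ?]]; apply/shortest_distance_ltP; exists i, j.
by do 2 (apply: bigcup_measurable => ? _); exact: measurable_iter_dist_lt.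
Qed.

Lemma measure_shortest_distance_lt n (r : R) :
  (P [set z : M * M | (D n z.1 z.2 < r%:E)%E] <=
   (n%:R ^+ 2 * fine (correlation_integral skew_dist nu r))%:E)%E.
Proof.
rewrite expr2 -mulrA.
pose A i := \bigcup_(j in [set j | (j < n)%N])
  [set z : M * M | skew_dist (iter i S z.1) (iter j S z.2) < r].
have mA i : measurable (A i).
  by apply: bigcup_measurable => j _; exact: measurable_iter_dist_lt.
apply: (@measure_le_sum_cover _ _ _ P A) => //.
- exact: measurable_shortest_distance_lt.
- move=> i ni; apply: (@measure_le_sum_cover _ _ _ P
    (fun j => [set z : M * M | skew_dist (iter i S z.1) (iter j S z.2) < r])) => //.
  + by move=> j; exact: measurable_iter_dist_lt.
  + move=> j _; rewrite correlation_integral_fine; last first.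
      by move=> r'; exact: measurable_skew_dist_lt.
    by rewrite -(measure_iter_dist_lt i j).
- move=> z /= /shortest_distance_ltP [i [j [? ? ?]]].
  by exists i => //; exists j.
Qed.

Let rot_lt (c r : R) :=
  [set z : M * M | circle_dist (z.1.2 + circle_proj c) z.2.2 < r].

Lemma measurable_rotation_dist_lt c r : measurable (rot_lt c r).
Proof.
have : measurable_fun [set: M * M] (fun z => (z.1.2 + circle_proj c, z.2.2)).
  apply: measurable_fun_pair; last exact: measurableT_comp.
  apply: (measurableT_comp (@measurable_circle_translate R (circle_proj c))).
  exact: measurableT_comp.
by move=> /(_ measurableT _ (measurable_circle_dist_lt r)); rewrite setTI.
Qed.

(** Once the first point is fixed, the second is confined to [Omega] times an arc, whatever the
    rotation. *)
Lemma measure_rotation_dist_lt c r : 0 < r ->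
  (P (rot_lt c r) <= (2 * r)%:E)%E.
Proof.
move=> r0; rewrite /P /product_measure1.
apply: (@le_trans _ _ (\int[nu]_x (2 * r)%:E)%E).
  apply: ge0_le_integral => //.
  - exact: (measurable_fun_xsection _ (measurable_rotation_dist_lt c r)).
  - move=> x _ /=.
    have -> : xsection (rot_lt c r) x = [set: Omega] `*`
        [set t | circle_dist (x.2 + circle_proj c) t < r].
      by apply/seteqP; split=> -[w t]; rewrite xsectionE//= => -[].
    rewrite /nu /skew_measure product_measure1E//; last exact: measurable_arc.
    rewrite [X in (X * _)%E](_ : _ = 1%E) ?mul1e; last exact: probability_setT.
    exact: circle_lebesgue_arc_le.
rewrite integral_cst// [X in (_ * X)%E](_ : _ = 1%E) ?mule1//.
exact: (@probability_setT _ _ _ (skew_measure mu)).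
Qed.

(** Rotating both circle coordinates by [- l * alpha] leaves only the difference of the two visit
    counts. *)
Lemma shortest_distance_lt_rotation n (r : R) z :
  (D n z.1 z.2 < r%:E)%E ->
  exists k l, [/\ (k < n)%N, (l < n)%N & rot_lt ((k%:R - l%:R) * alpha) r z].
Proof.
move=> /shortest_distance_ltP[i [j [ni nj]]].
rewrite /skew_dist gt_max => /andP[_].
have [k ki ->] := iter_skew_product_snd T alpha I i z.1.
have [l lj ->] := iter_skew_product_snd T alpha I j z.2.
move=> h; exists k, l; split; [exact: leq_ltn_trans ni|exact: leq_ltn_trans nj|].
rewrite /rot_lt/= -(circle_dist_translate _ _ (circle_proj (l%:R * alpha))).
by rewrite -addrA -circle_projD mulrBl subrK.
Qed.

Lemma measure_shortest_distance_lt_rotation n (r : R) : 0 < r ->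
  (P [set z : M * M | (D n z.1 z.2 < r%:E)%E] <= (4 * n%:R * r)%:E)%E.
Proof.
move=> r0; have -> : 4 * n%:R * r = (n.*2)%:R * (2 * r).
  by rewrite -mul2n natrM; ring.
apply: (@measure_le_sum_cover _ _ _ P
  (fun m => rot_lt ((m%:R - n%:R) * alpha) r)).
- exact: measurable_shortest_distance_lt.
- by move=> m; exact: measurable_rotation_dist_lt.
- by move=> m _; exact: measure_rotation_dist_lt.
- move=> z /= /shortest_distance_lt_rotation[k [l [kn ln h]]].
  (* The difference [k - l] lies strictly between [-n] and [n]; adding [n] makes it a natural number
     below [2 n]. *)
  exists (k + n - l)%N; first by lia.
  rewrite (_ : (k + n - l)%:R - n%:R = k%:R - l%:R :> R)//.
  by rewrite natrB ?natrD; [ring|lia].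
Qed.

(* Writing [k - l = L * q + j] with [0 <= j < q], the rotation by [k - l] is
   [`|L| * ||q alpha||]-close to the one by [j]. *)
Lemma measure_shortest_distance_lt_almost_period n q (r : R) :
  0 < r -> (0 < q)%N ->
  (P [set z : M * M | (D n z.1 z.2 < r%:E)%E] <=
   (2 * q%:R * r + 2 * (n + q)%:R * dist_int (q%:R * alpha))%:E)%E.
Proof.
move=> r0 q0; have qR : 0 < q%:R :> R by rewrite ltr0n.
have -> : 2 * q%:R * r + 2 * (n + q)%:R * dist_int (q%:R * alpha) =
    q%:R * (2 * (r + (n + q)%:R / q%:R * dist_int (q%:R * alpha))).
  by field; rewrite gt_eqF.
apply: (@measure_le_sum_cover _ _ _ P (fun j => rot_lt (j%:R * alpha)
  (r + (n + q)%:R / q%:R * dist_int (q%:R * alpha)))).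
- exact: measurable_shortest_distance_lt.
- by move=> m; exact: measurable_rotation_dist_lt.
- move=> m _; apply: measure_rotation_dist_lt.
  by rewrite ltr_wpDr// !mulr_ge0 ?dist_int_ge0// invr_ge0 ltW.
- move=> z /= /shortest_distance_lt_rotation[k [l [kn ln h]]].
  (* Adding [n * q], which exceeds [l], keeps the natural subtraction exact without changing the
     residue modulo [q]; [L] takes the [n] back. *)
  pose m := (k + n * q - l)%N; exists (m %% q)%N; first by rewrite ltn_mod.
  pose L : int := (m %/ q)%:Z - n%:Z.
  have lnq : (l <= k + n * q)%N.
    apply: leq_trans (ltnW ln) _; apply: leq_trans (leq_addl _ _).
    by rewrite leq_pmulr.
  have kl : k%:R - l%:R = L%:~R * q%:R + (m %% q)%:R :> R.
    have : m%:R = (m %/ q)%:R * q%:R + (m %% q)%:R :> R.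
      by rewrite -natrM -natrD -divn_eq.
    rewrite {1}/m natrB// natrD natrM /L intrB -!pmulrn => mE.
    by rewrite mulrBl; lra.
  (* Indeed [L * q = k - l - j] with [j = m %% q], and this has absolute value at most [n + q]. *)
  have Lq : `|L|%N%:R <= (n + q)%:R / q%:R :> R.
    rewrite ler_pdivlMr// natr_absz intr_norm -[X in _ * X](ger0_norm (ltW qR)).
    rewrite -normrM (_ : _ * _ = k%:R - l%:R - (m %% q)%:R); last by rewrite kl addrK.
    have [k0 l0 j0] : [/\ 0 <= k%:R :> R, 0 <= l%:R :> R & 0 <= (m %% q)%:R :> R].
      by split.
    have kR : k%:R <= n%:R :> R by rewrite ler_nat ltnW.
    have lR : l%:R <= n%:R :> R by rewrite ler_nat ltnW.
    have jR : (m %% q)%:R <= q%:R :> R by rewrite ler_nat ltnW// ltn_mod.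
    by rewrite natrD ler_norml; apply/andP; split; lra.
  rewrite /rot_lt/=; apply: le_lt_trans
    (circle_dist_triangle (z.1.2 + circle_proj ((k%:R - l%:R) * alpha)) _ _) _.
  rewrite addrC ltr_leD//.
  rewrite !(addrC z.1.2) circle_dist_translate circle_dist_proj kl.
  rewrite -mulrBl opprD addrCA subrr addr0 mulNr dist_intN -mulrA.
  apply: le_trans (dist_int_mulz _ _) _.
  by rewrite ler_wpM2r// dist_int_ge0.
Qed.

End skew_shortest_distance.

(** * Good rational approximations and the irrationality exponent *)

Lemma gt0_powRD (R : realType) (x r s : R) : 0 < x ->
  x `^ (r + s) = x `^ r * x `^ s.
Proof. by move=> x0; rewrite powRD// (gt_eqF x0) implybT. Qed.

Lemma limn_einf_ge_near (R : realType) (u : (\bar R)^nat) (l : \bar R) :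
  (\forall n \near \oo, (l <= u n)%E) -> (l <= limn_einf u)%E.
Proof.
move=> lu; rewrite /limn_einf leeNr; apply: limn_esup_le_near.
by apply: filterS lu => n; rewrite leeN2.
Qed.

(** Otherwise the lower limit at [b] would be at least 1, and [b] would belong to the set whose
    infimum is the exponent. *)
Lemma irrationality_exponent_frequently (R : realType) (alpha b : R) (N : nat) :
  (b%:E < irrationality_exponent alpha)%E ->
  exists2 q : nat, (N <= q)%N & q%:R `^ b * dist_int (q%:R * alpha) < 1.
Proof.
move=> bg; apply: contrapT => h.
have : (irrationality_exponent alpha <= b%:E)%E.
  apply: ereal_inf_lbound; exists b => //=.
  apply: (@lt_le_trans _ _ 1%:E); first by rewrite lte_fin.
  apply: limn_einf_ge_near; exists N => // q /= Nq.
  by rewrite lee_fin leNgt; apply/negP => hq; apply: h; exists q.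
by rewrite leNgt bg.
Qed.

(** For [b < 0] the factor [q^b] tends to 0 while [dist_int] stays bounded, so [b] is not
    admissible. This excludes the value [-oo]. *)
Lemma irrationality_exponent_ge0 (R : realType) (alpha : R) :
  (0 <= irrationality_exponent alpha)%E.
Proof.
apply: le_ereal_inf_tmp => _ [b /= hb <-]; rewrite lee_fin leNgt; apply/negP => b0.
suff : (limn_einf (fun q : nat => (q%:R `^ b * dist_int (q%:R * alpha))%:E) <= 0)%E.
  by rewrite leNgt hb.
apply/lee_addgt0Pr => e e0; rewrite add0e.
apply: limn_einf_le_frequently => N.
have [N' hN'] := @powR_eventually_lt R (- b) e (ltac:(by rewrite oppr_gt0)) e0.
exists (maxn N N'); first exact: leq_maxl.
have := hN' _ (leq_maxr N N'); rewrite opprK lee_fin => h.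
apply: le_trans (ltW h); rewrite ler_piMr ?powR_ge0//.
set x := _ * alpha.
apply: le_trans (dist_int_le _ (Num.floor x)) _.
rewrite ger0_norm ?subr_ge0 ?floor_le//.
by have := lt_succ_floor x; rewrite intrD; lra.
Qed.

(** * The almost sure bounds *)

Section limits.
Context d (R : realType) (Omega : borelMetricType d R).
Variables (T : Omega -> Omega) (alpha : R) (I : set Omega).
Variable mu : probability Omega R.
Hypothesis mT : measurable_fun [set: Omega] T.
Hypothesis mI : measurable I.
Hypothesis muT : invariant_measure T mu.
Hypothesis sc : @second_countable Omega.
Let S := skew_product T alpha I.
Let nu := skew_measure mu.

Lemma ae_limn_esup_le_dimension (C : R) :
  is_correlation_dimension (@mdist R Omega) mu C ->
  {ae (nu \x nu)%E, forall z,
    (limn_esup (log_shortest_distance skew_dist S z.1 z.2) <= (2 / (C + 1))%:E)%E}.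
Proof.
move=> hC.
have C0 : 0 <= C by apply: (correlation_dimension_ge0 _ hC) => r; exact: measurable_mdist_lt.
have C1 : 0 < C + 1 by rewrite ltr_wpDl.
apply: ae_le_inf => e e0; set a := 2 / (C + 1) + e.
have a0 : 0 < a by rewrite addr_gt0// divr_gt0.
have aC : 2 < a * (C + 1) by rewrite /a mulrDl divfK ?gt_eqF// ltrDl mulr_gt0.
(* The midpoint of [2 / a] and [C + 1]: below the dimension, yet with [a * s > 2], so that
   [n^2 * n^(- a s)] decays. *)
pose s := ((C + 1) + 2 / a) / 2.
have sC : s < C + 1.
  have : 2 / a < C + 1 by rewrite ltr_pdivrMr// mulrC.
  by rewrite /s; lra.
have as2 : 2 < a * s.
  have -> : a * s = (a * (C + 1) + 2) / 2 by rewrite /s; field; rewrite gt_eqF.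
  by lra.
have [del /= del0 hdel] := skew_correlation_integral_le sc hC sC.
have [N hN] := powR_eventually_lt a0 del0.
apply: (@ae_limn_esup_log_le _ _ R (nu \x nu)%E
  (fun z n => shortest_distance skew_dist S n z.1 z.2) _ _ a (a * s - 2) 1).
- by move=> z m n; exact: shortest_distance_anti.
- by move=> n r; exact: measurable_shortest_distance_lt.
- exact: ltW.
- by rewrite subr_gt0.
- exact: ler01.
- exists N.+1 => // n /= Nn.
  have n0 : 0 < n%:R :> R by rewrite ltr0n (leq_ltn_trans _ Nn).
  have na0 : 0 < n%:R `^ (- a) :> R by rewrite powR_gt0.
  apply: le_trans (measure_shortest_distance_lt alpha mT mI muT sc n _) _.
  rewrite lee_fin mul1r opprB gt0_powRD//.
  rewrite -[2]/(2%:R) (powR_mulrn _ (ltW n0)) ler_wpM2l ?exprn_ge0//.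
  rewrite -mulNr powRrM -lee_fin correlation_integral_fine.
    apply: hdel => //=; rewrite sub0r normrN gtr0_norm//.
    by apply: hN; exact: ltnW.
  by move=> r; exact: measurable_skew_dist_lt.
Qed.

Lemma ae_limn_esup_le1 :
  {ae (nu \x nu)%E, forall z,
    (limn_esup (log_shortest_distance skew_dist S z.1 z.2) <= 1)%E}.
Proof.
apply: ae_le_inf => e e0.
apply: (@ae_limn_esup_log_le _ _ R (nu \x nu)%E
  (fun z n => shortest_distance skew_dist S n z.1 z.2) _ _ (1 + e) e 4).
- by move=> z m n; exact: shortest_distance_anti.
- by move=> n r; exact: measurable_shortest_distance_lt.
- by rewrite addr_ge0// ltW.
- by [].
- by [].
- exists 1%N => // n /= n1.
  have n0 : 0 < n%:R :> R by rewrite ltr0n.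
  apply: le_trans (measure_shortest_distance_lt_rotation alpha mu mT mI sc n _) _.
    by rewrite powR_gt0.
  rewrite lee_fin -mulrA ler_wpM2l// -{1}[n%:R](powRr1 (ltW n0)).
  rewrite -gt0_powRD//.
  by rewrite opprD addrA subrr add0r.
Qed.

(* Along the [q] with [||q alpha|| < q ^ - b], take [n = floor (q ^ c)]. *)
Lemma ae_limn_einf_le_inv (b c : R) :
  1 < c -> c < b -> (b%:E < irrationality_exponent alpha)%E ->
  {ae (nu \x nu)%E, forall z,
    (limn_einf (log_shortest_distance skew_dist S z.1 z.2) <= (c^-1)%:E)%E}.
Proof.
move=> c1 cb bg; have c0 : 0 < c by lra.
apply: ae_le_inf => e e0; set a := c^-1 + e.
have a0 : 0 < a by rewrite addr_gt0 ?invr_gt0.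
have ac : 0 < a * c - 1 by rewrite /a mulrDl mulVf ?gt_eqF// addrAC subrr add0r mulr_gt0.
apply: (@ae_limn_einf_log_le _ _ R (nu \x nu)%E
  (fun z n => shortest_distance skew_dist S n z.1 z.2)).
  by move=> n r; exact: measurable_shortest_distance_lt.
move=> eps N eps0.
(* One factor 2 comes from the measure of an arc; [2^a] pays for [n] being only at least
   [q^c / 2]. *)
pose K := 2 * 2 `^ a : R.
have K0 : 0 < K by rewrite mulr_gt0// powR_gt0.
have bc0 : 0 < b - c by rewrite subr_gt0.
(* [N1] makes the arc term [K * q^(1 - a c)] at most [eps / 2], and [N2] does so for the drift term
   [4 * q^(c - b)]. *)
have [N1 h1] := @powR_eventually_lt R _ _ ac (divr_gt0 (divr_gt0 eps0 (ltr0n _ 2)) K0).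
have [N2 h2] := @powR_eventually_lt R _ _ bc0 (divr_gt0 (divr_gt0 eps0 (ltr0n _ 2)) (ltr0n _ 4)).
have [q] := @irrationality_exponent_frequently R alpha b (maxn N (maxn 1 (maxn N1 N2))) bg.
rewrite !geq_max => /and4P[Nq q1 N1q N2q] qa.
have q0 : 0 < q%:R :> R by rewrite ltr0n.
have qle : q%:R <= q%:R `^ c :> R.
  by rewrite -{1}[q%:R](powRr1 (ltW q0)) ler_powR ?ler1n// ltW.
pose n := Num.truncn (q%:R `^ c : R).
have qn : (q <= n)%N by rewrite truncn_ge_nat ?powR_ge0.
have nle : n%:R <= q%:R `^ c :> R by rewrite truncn_le powR_ge0.
have nge : q%:R `^ c <= 2 * n%:R :> R.
  have := truncnS_gt (q%:R `^ c : R); rewrite -/n.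
  have : 1 <= n%:R :> R by rewrite ler1n (leq_trans q1).
  by rewrite -natr1; lra.
exists n; first exact: leq_trans qn.
have n0 : 0 < n%:R :> R by rewrite ltr0n (leq_trans q1).
apply: le_trans (measure_shortest_distance_lt_almost_period alpha mu mT mI sc n _ q1) _.
  by rewrite powR_gt0.
rewrite lee_fin (splitr eps) lerD//.
- have na : n%:R `^ (- a) <= 2 `^ a * q%:R `^ (- (a * c)) :> R.
    rewrite !powRN ler_pdivlMr ?powR_gt0// mulrC ler_pdivrMr ?powR_gt0//.
    rewrite -powRM// [a * c]mulrC powRrM ge0_ler_powR ?nnegrE ?powR_ge0 ?mulr_ge0//.
    exact: ltW.
  have : K * q%:R `^ (- (a * c - 1)) <= eps / 2.
    by rewrite mulrC -ler_pdivlMr// ltW// h1.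
  apply: le_trans; rewrite /K opprB (gt0_powRD 1 _ q0).
  rewrite (powRr1 (ltW q0)).
  have -> : 2 * 2 `^ a * (q%:R * q%:R `^ (- (a * c))) =
      2 * q%:R * (2 `^ a * q%:R `^ (- (a * c))) :> R by ring.
  by rewrite ler_wpM2l.
- have : 4 * q%:R `^ (- (b - c)) <= eps / 2.
    by rewrite mulrC -ler_pdivlMr// ltW// h2.
  apply: le_trans; rewrite opprB (gt0_powRD c _ q0).
  have -> : 4 * (q%:R `^ c * q%:R `^ (- b)) = 2 * (2 * q%:R `^ c) * q%:R `^ (- b) :> R.
    by ring.
  apply: ler_pM; rewrite ?mulr_ge0 ?dist_int_ge0//.
    by rewrite ler_wpM2l// natrD; lra.
  by rewrite powRN -[leRHS]mul1r ler_pdivlMr ?powR_gt0// mulrC ltW.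
Qed.

(** If the exponent exceeds 1, [c] approaches it from below. If it is at most 1, its inverse is at
    least 1 and the bound on the upper limit suffices. *)
Lemma ae_limn_einf_le_irrationality_exponent :
  {ae (nu \x nu)%E, forall z,
    (limn_einf (log_shortest_distance skew_dist S z.1 z.2) <=
     (irrationality_exponent alpha)^-1)%E}.
Proof.
have := irrationality_exponent_ge0 alpha.
have H c : 1 < c -> (c%:E < irrationality_exponent alpha)%E ->
    {ae (nu \x nu)%E, forall z,
      (limn_einf (log_shortest_distance skew_dist S z.1 z.2) <= (c^-1)%:E)%E}.
  move=> c1 cg.
  have [b cb bg] : exists2 b, c < b & (b%:E < irrationality_exponent alpha)%E.
    case: (irrationality_exponent alpha) cg => [r| |] //.
      rewrite lte_fin => cr; exists ((c + r) / 2); first by lra.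
      by rewrite lte_fin; lra.
    by move=> _; exists (c + 1); [lra|exact: ltry].
  exact: ae_limn_einf_le_inv cb bg.
case: (irrationality_exponent alpha) H => [g| |] // H; last first.
  move=> _; rewrite invey; apply: ae_le_inf => e e0.
  have e10 : 0 < e^-1 by rewrite invr_gt0.
  (* Any [c > 1] is allowed here; this one has [c^-1 <= e]. *)
  have := H (2 + e^-1) (ltac:(lra)) (ltry _).
  apply: filterS => z /le_trans; apply; rewrite add0r lee_fin.
  by rewrite -[leRHS]invrK lef_pV2 ?posrE; lra.
rewrite lee_fin => g0.
have [g1|g1] := leP g 1.
  apply: filterS ae_limn_esup_le1 => z z1.
  apply: le_trans (limn_einf_sup _) (le_trans z1 _).
  rewrite inver; case: eqVneq => [_|g0']; first exact: leey.
  by rewrite lee_fin invf_ge1// lt_neqAle eq_sym g0'.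
rewrite inver gt_eqF; last by lra.
apply: ae_le_inf => e e0.
(* The first entry ensures [c > 1], the second [c^-1 <= g^-1 + e], and both are below [g]. *)
pose c := Num.max ((1 + g) / 2) (g^-1 + e)^-1.
have ge0 : 0 < g^-1 + e by rewrite addr_gt0// invr_gt0; lra.
have c1 : 1 < c by rewrite lt_max; apply/orP; left; lra.
have cg : c < g.
  rewrite gt_max; apply/andP; split; first by lra.
  rewrite -[ltRHS]invrK ltf_pV2 ?posrE// ?invr_gt0; last by lra.
  by rewrite ltrDl.
have := H c c1 cg; apply: filterS => z /le_trans; apply; rewrite lee_fin.
rewrite -[leRHS]invrK lef_pV2 ?posrE ?invr_gt0//; last by lra.
by rewrite le_max lexx orbT.
Qed.

End limits.

Theorem theorem5p3 (R : realType) (d : measure_display)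
    (Omega : borelMetricType d R) (n : nat) (X : smooth_manifold n Omega)
    (g : riemannian_metric X) (T : Omega -> Omega) (p : nat)
    (J : 'I_p -> set Omega) (beta eta : R) (psi : Omega -> R)
    (mu : probability Omega R) (W : set (seq 'I_p)) (I : set Omega)
    (alpha Cmu : R)
    (hdist : is_riemannian_distance g)
    (hmarkov : piecewise_expanding_markov g T J beta eta)
    (hmeas : measurable_fun [set: Omega] T)
    (hmixing : topologically_mixing T)
    (hpsi : forall i, holder_on (J i)° psi)
    (hmu : is_equilibrium_state T psi mu)
    (hCmu : is_correlation_dimension (@mdist R Omega) mu Cmu)
    (hI : I = cylinder_union T J W)
    (hNA : condition_NA R T J W)
    (halpha : irrational alpha) :
  let S := skew_product T alpha I in
  let nu := skew_measure mu in
  exists Cnu : R,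
    [/\ is_correlation_dimension skew_dist nu Cnu,
        Cnu = Cmu + 1,
        {ae (nu \x nu)%E, forall xy,
          (limn_esup (log_shortest_distance skew_dist S xy.1 xy.2)
             <= Order.min (2 / Cnu)%:E 1)%E} &
        {ae (nu \x nu)%E, forall xy,
          (limn_einf (log_shortest_distance skew_dist S xy.1 xy.2)
             <= Order.min (2 / Cnu)%:E (irrationality_exponent alpha)^-1)%E}].
Proof.
move=> S nu; have sc := smooth_manifold_second_countable X.
have [muT _ _] := hmu.
have mI : measurable I.
  by rewrite hI; apply: measurable_cylinder_union => //; exact: markov_closed hmarkov.
have esup2 := @ae_limn_esup_le_dimension _ _ _ T alpha I mu hmeas mI muT sc Cmu hCmu.
have esup1 := @ae_limn_esup_le1 _ _ _ T alpha I mu hmeas mI sc.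
have einf := @ae_limn_einf_le_irrationality_exponent _ _ _ T alpha I mu hmeas mI sc.
exists (Cmu + 1); split => //.
- exact: skew_correlation_dimension.
- by apply: filterS2 esup2 esup1 => z z2 z1; rewrite le_min z2.
- apply: filterS2 esup2 einf => z z2 zg; rewrite le_min zg andbT.
  exact: le_trans (limn_einf_sup _) z2.
Qed.
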